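(* Let $m<\infty$ be fixed and let $z$ be a binary string of length $l\le m$. Let the data $D$ be sampled i.i.d. from the true distribution $\dot q$ on $\Gamma$. Then, with probability 1, as $n_z\to\infty$: (a) the posterior satisfies $p_z(x|D_z)\to\dot q_z(x)$ for all $x\in\Gamma_z$; (b) if $\dot q_z(\cdot)$ is uniform on $\Gamma_z$ and $l<m$, then the evidence satisfies $p_z(D_z)\to u$ polynomially in $n_z$; (c) if $l=m$, then $p_z(D_z)\equiv 1$; (d) if $\dot q_z(\cdot)$ is non-uniform on $\Gamma_z$, then $p_z(D_z)\to\infty$ exponentially in $n_z$, provided $s>0$.
   Context: Tree partition. $\Gamma$ is a sample space of total volume $|\Gamma|=1$, $m$ is a finite tree height, and $\mathbb B_k^m=\bigcup_{i=k}^m\{0,1\}^i$ is the set of binary strings of length between $k$ and $m$ (empty if $k>m$). For each $z\in\mathbb B_0^m$ there is a set $\Gamma_z\subseteq\Gamma$, with $\Gamma_\epsilon=\Gamma$ for the empty string $\epsilon$, and for $\ell(z)<m$ the set $\Gamma_z$ is the disjoint union of $\Gamma_{z0}$ and $\Gamma_{z1}$ with $|\Gamma_{z0}|=|\Gamma_{z1}|=\frac12|\Gamma_z|$ (e.g. $\Gamma=[0,1)$ with dyadic intervals). For $x\in\Gamma$, $x_{1:i}$ is the unique string of length $i$ with $x\in\Gamma_{x_{1:i}}$. Write $l=\ell(z)$ for the length of $z$. Models. All distributions $q$ on $\Gamma$ considered (including the true one $\dot q$) have density constant on each cell $\Gamma_{x'}$, $\ell(x')=m$. Such a $q$ is parametrized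 by branching probabilities $q_{z0}=P[\Gamma_{z0}|\Gamma_z,q]$ and $q_{z1}=P[\Gamma_{z1}|\Gamma_z,q]$, with $q_{z0}+q_{z1}=1$. Let $\vec q_{z*}:=(q_{zy}:y\in\mathbb B_1^{m-l})$. The branching probabilities of $\dot q$ are denoted $\dot q_{z0},\dot q_{z1}$. Prior. Fix parameters $\alpha>0$ and $u,s\in[0,1]$ with $u+s=1$. The prior $p_z(\vec q_{z*})$ (a probability measure, written as a generalized density with Dirac deltas) is defined recursively: $p_z(\vec q_{z*})=1$ if $\ell(z)=m$ (empty collection), and for $\ell(z)<m$ $$p_z(\vec q_{z*})=u\prod_{y\in\mathbb B_1^{m-l}}\delta(q_{zy}-\tfrac12)+s\cdot\mathrm{Beta}(q_{z0},q_{z1}|\alpha,\alpha)\,p_{z0}(\vec q_{z0*})\,p_{z1}(\vec q_{z1*}),$$ where $\mathrm{Beta}(p,q|a,b)=\frac{\Gamma(a+b)}{\Gamma(a)\Gamma(b)}p^{a-1}q^{b-1}\delta(p+q-1)$ and $\Gamma(\cdot)$ with a real argument is the Gamma function. Likelihood, evidence, posterior of $x$. The data is $D=(x^1,\dots,x^n)$; $D_z$ is the sublist (with multiplicity) of points of $D$ lying in $\Gamma_z$, and $n_z:=|D_z|$. For $x\in\Gamma_z$, $p_z(x|q):=\prod_{i=l+1}^m 2q_{x_{1:i}}$ (empty product $=1$), and $p_z(D_z|\vec q_{z*}):=\prod_{x\in D_z}p_z(x|q)$. The evidence is $p_z(D_z):=\int p_z(D_z|\vec q_{z*})\,p_z(\vec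 q_{z*})\,d\vec q_{z*}$, and for $x\in\Gamma_z$ the posterior (predictive) distribution is $p_z(x|D_z):=p_z(D_z,x)/p_z(D_z)$, where $p_z(D_z,x)$ is the evidence of the list $D_z$ with $x$ appended. True distribution. $\dot q_z(x):=p_z(x|\dot q)=\prod_{i=l+1}^m 2\dot q_{x_{1:i}}$ for $x\in\Gamma_z$; $\dot q_z(\cdot)$ is uniform on $\Gamma_z$ iff $\dot q_z(x)=1$ for all $x\in\Gamma_z$.
   Formalization: Part (a) is stated under the extra assumption that s>0 or the true distribution is uniform on Γ_z, because for s=0 the posterior is identically 1 and (a) fails for non-uniform true distributions. *)

(* Defs.v *)
From HB Require Import structures.
From mathcomp Require Import all_boot all_order all_algebra.
From mathcomp Require Import all_classical all_reals all_analysis.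
From mathcomp Require Import measurable_realfun.

Set Implicit Arguments.
Unset Strict Implicit.
Unset Printing Implicit Defensive.

Import Order.TTheory GRing.Theory Num.Theory.
Import numFieldNormedType.Exports.

Local Open Scope classical_set_scope.
Local Open Scope ring_scope.

Section tree_partition.
Context {d : measure_display} {T : measurableType d} {R : realType}.

(* The string z0 (resp. z1) is [rcons z false] (resp. [rcons z true]); only the
   cells of strings of length at most m are constrained. *)
Record tree_partition (vol : probability T R) (m : nat)
    (cell : bitseq -> set T) : Prop := TreePartition {
  cell_measurable : forall z, (size z <= m)%N -> measurable (cell z) ;
  cell_nil : cell [::] = [set: T] ;
  cell_split : forall z, (size z < m)%N ->
    cell z = cell (rcons z false) `|` cell (rcons z true) ;
  cell_disjoint : forall z, (size z < m)%N ->
    cell (rcons z false) `&` cell (rcons z true) = set0 ;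
  cell_half : forall z b, (size z < m)%N ->
    vol (cell (rcons z b)) = (2^-1%:E * vol (cell z))%E }.

(* x_{1:i}; the string is unique for a tree partition and i <= m. *)
Definition address (cell : bitseq -> set T) (i : nat) (x : T) : bitseq :=
  xget [::] [set w : bitseq | size w = i /\ cell w x].

(* The branching probability q_{zb} = P[Γ_{zb} | Γ_z] is specified by
   P[Γ_{zb}] = q_{zb} P[Γ_z]; below a null cell it is arbitrary in [0, 1]. *)
Record tree_model (vol : probability T R) (m : nat) (cell : bitseq -> set T)
    (P : probability T R) (q : bitseq -> R) : Prop := TreeModel {
  model_density : exists f : bitseq -> R,
    (forall w, 0 <= f w) /\
    forall A, measurable A ->
      P A = (\int[vol]_(x in A) (f (address cell m x))%:E)%E ;
  branch_ge0 : forall z b, (size z < m)%N -> 0 <= q (rcons z b) ;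
  branch_sum : forall z, (size z < m)%N ->
    q (rcons z false) + q (rcons z true) = 1 ;
  branch_cond : forall z b, (size z < m)%N ->
    P (cell (rcons z b)) = ((q (rcons z b))%:E * P (cell z))%E }.

(* p_z(x | q) *)
Definition likelihood1 (m : nat) (cell : bitseq -> set T) (z : bitseq)
    (q : bitseq -> R) (x : T) : R :=
  \prod_((size z).+1 <= i < m.+1) (2 * q (address cell i x)).

(* p_z(E | q) for a list E of points of Γ_z *)
Definition likelihood (m : nat) (cell : bitseq -> set T) (z : bitseq)
    (q : bitseq -> R) (E : seq T) : R :=
  \prod_(x <- E) likelihood1 m cell z q x.

(* D_z *)
Definition sublist (cell : bitseq -> set T) (z : bitseq) (D : seq T) : seq T :=
  [seq x <- D | x \in cell z].

Definition is_uniform (m : nat) (cell : bitseq -> set T) (q : bitseq -> R)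
    (z : bitseq) : Prop :=
  forall x, cell z x -> likelihood1 m cell z q x = 1.

End tree_partition.

Section iid.
Context {d d' : measure_display} {Om : measurableType d} {T : measurableType d'}
  {R : realType}.

(* Independence of every finite subfamily follows from the initial segments by
   taking A i to be the full space. *)
Record iid (Pr : probability Om R) (P : probability T R)
    (X : nat -> {mfun Om >-> T}) : Prop := IID {
  iid_law : forall i (A : set T), measurable A -> distribution Pr (X i) A = P A ;
  iid_indep : forall (n : nat) (A : nat -> set T),
    (forall i, measurable (A i)) ->
    Pr (\bigcap_(i in `I_n) (X i @^-1` A i)) =
      (\prod_(i < n) fine (Pr (X i @^-1` A i)))%:E }.

(* x^1, ..., x^n *)
Definition sample (X : nat -> {mfun Om >-> T}) (n : nat) (w : Om) : seq T :=
  [seq X i w | i <- iota 0 n].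

End iid.

Section beta.
Context {R : realType}.
Local Notation leb := (@lebesgue_measure R).

Definition Gamma (a : R) : R :=
  \int[leb]_(t in `]0, +oo[) (t `^ (a - 1) * expR (- t)).

Definition beta_density (a b p q : R) : R :=
  Gamma (a + b) / (Gamma a * Gamma b) * p `^ (a - 1) * q `^ (b - 1).

(* Beta(p, q | a, b) as a measure on pairs (p, q): the factor δ(p + q - 1)
   carries the density p |-> beta_density a b p (1 - p) to the segment
   {(p, 1 - p) : 0 < p < 1}. *)
Definition beta_measure (a b : R) (A : set (R * R)) : \bar R :=
  (\int[leb]_(p in `]0%R, 1%R[ `&` [set p | A (p, 1 - p)%R])
     (beta_density a b p (1 - p))%:E)%E.

Lemma Gamma_ge0 a : 0 <= Gamma a.
Proof.
by apply: Rintegral_ge0 => // t _; rewrite mulr_ge0 ?powR_ge0 ?expR_ge0.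
Qed.

Lemma beta_density_ge0 a b p q : 0 <= beta_density a b p q.
Proof.
by rewrite /beta_density !mulr_ge0 ?powR_ge0 ?invr_ge0 ?mulr_ge0 ?Gamma_ge0.
Qed.

Lemma measurable_beta_density a b :
  measurable_fun [set: R] (fun p => beta_density a b p (1 - p)).
Proof.
apply: measurable_funM; first exact: measurable_funM.
apply: (measurableT_comp (measurable_powR _)).
exact: measurable_funB.
Qed.

Lemma measurable_segment : measurable_fun [set: R] (fun p : R => (p, 1 - p)).
Proof. by apply: measurable_fun_pair => //; exact: measurable_funB. Qed.

End beta.

Section beta_is_measure.
Context {R : realType} (a b : R).
Local Open Scope ereal_scope.
Local Notation leb := (@lebesgue_measure R).

Let trace (A : set (R * R)) := `]0%R, 1%R[ `&` [set p : R | A (p, 1 - p)%R].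

Let measurable_trace A : measurable A -> measurable (trace A).
Proof.
move=> mA; apply: measurableI => //.
by rewrite -[X in measurable X]setTI; exact: measurable_segment.
Qed.

Let beta0 : beta_measure a b set0 = 0.
Proof.
rewrite /beta_measure (_ : _ `&` _ = set0) ?integral_set0//.
by apply/seteqP; split => p //= [].
Qed.

Let beta_ge0 A : 0 <= beta_measure a b A.
Proof. by apply: integral_ge0 => p _; rewrite lee_fin beta_density_ge0. Qed.

Let beta_sigma_additive : semi_sigma_additive (beta_measure a b).
Proof.
move=> F mF tF mUF.
have -> : beta_measure a b (\bigcup_n F n) = \sum_(n <oo) beta_measure a b (F n).
  rewrite /beta_measure [X in \int[_]_(_ in X) _](_ : _ = \bigcup_n trace (F n)).
    rewrite ge0_integral_bigcup//.
    - by move=> n; exact: measurable_trace.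
    - by apply/measurable_funTS/measurable_EFinP; exact: measurable_beta_density.
    - by move=> p _; rewrite lee_fin beta_density_ge0.
    - move=> i j _ _ [p [[_ Fi] [_ Fj]]]; apply: tF => //.
      by exists (p, 1 - p)%R.
  rewrite /trace -setI_bigcupr; congr (_ `&` _).
by apply: is_cvg_nneseries => n _ _; exact: beta_ge0.
Qed.

HB.instance Definition _ := isMeasure.Build _ _ _ (beta_measure a b)
  beta0 beta_ge0 beta_sigma_additive.

Let beta_sigma_finite : sigma_finite setT (beta_measure a b).
Proof.
pose g (t : R * R) := beta_density a b t.1 t.2.
have mg : measurable_fun setT g.
  apply: measurable_funM; first apply: measurable_funM => //.
  - exact: (measurableT_comp (measurable_powR _)).
  - exact: (measurableT_comp (measurable_powR _)).
exists (fun n => [set t | (g t <= n%:R)%R]).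
  apply/seteqP; split => // t _; exists (Num.truncn (g t)).+1 => //=.
  by rewrite ltW// truncnS_gt.
move=> n; have mn : measurable [set t | (g t <= n%:R)%R].
  rewrite -[X in measurable X]setTI (_ : [set t | _] = g @^-1` `]-oo, n%:R]).
    exact: mg.
  by apply/seteqP; split => t /=; rewrite in_itv.
split => //; rewrite /beta_measure.
apply: (@le_lt_trans _ _
  (\int[leb]_(p in trace [set t | (g t <= n%:R)%R]) n%:R%:E)).
  apply: ge0_le_integral => //.
  - exact: measurable_trace.
  - by move=> p _; rewrite lee_fin beta_density_ge0.
  - by apply/measurable_funTS/measurable_EFinP; exact: measurable_beta_density.
  - by move=> p [_ /=]; rewrite lee_fin.
rewrite integral_cst; last exact: measurable_trace.
rewrite lte_mul_pinfty// ?lee_fin//.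
apply: (@le_lt_trans _ _ (leb `]0%R, 1%R[)).
  by apply: le_measure; rewrite ?inE//=; [exact: measurable_trace|move=> p []].
by rewrite lebesgue_measure_itv/= lte_fin ltr01 -EFinB ltry.
Qed.

HB.instance Definition _ := Measure_isSigmaFinite.Build _ _ _
  (beta_measure a b) beta_sigma_finite.

End beta_is_measure.

(* The library's sigma-finite structure on [m1 \x m2] is shadowed by the one it
   declares for subprobabilities, hence this alias. *)
Section product.
Context {d1 d2 : measure_display} {T1 : measurableType d1}
  {T2 : measurableType d2} {R : realType}.
Variable m1 : {sigma_finite_measure set T1 -> \bar R}.
Variable m2 : {sigma_finite_measure set T2 -> \bar R}.
Local Open Scope ereal_scope.

Definition sf_product : set (T1 * T2) -> \bar R := m1 \x m2.

HB.instance Definition _ := Measure.on sf_product.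

Let sf_product_sigma_finite : sigma_finite setT sf_product.
Proof.
have /sigma_finiteP[F [TF ndF Foo]] := sigma_finiteT m1.
have /sigma_finiteP[G [TG ndG Goo]] := sigma_finiteT m2.
exists (fun n => F n `*` G n).
  apply/seteqP; split => // -[x y] _.
  have [i _ Fi] : (\bigcup_i F i) x by rewrite -TF.
  have [j _ Gj] : (\bigcup_j G j) y by rewrite -TG.
  exists (maxn i j) => //; split => /=.
  - by move: x Fi; exact/subsetPset/ndF/leq_maxl.
  - by move: y Gj; exact/subsetPset/ndG/leq_maxr.
move=> n; have [? ?] := Foo n; have [? ?] := Goo n.
split; first exact: measurableX.
by rewrite /sf_product product_measure1E// lte_mul_pinfty// ge0_fin_numE.
Qed.

HB.instance Definition _ := Measure_isSigmaFinite.Build _ _ _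
  sf_product sf_product_sigma_finite.

End product.

Section mixture.
Context {d : measure_display} {T : measurableType d} {R : realType}.
Variables (u s : {nonneg R}).
Variables (m1 m2 : {sigma_finite_measure set T -> \bar R}).
Local Open Scope ereal_scope.

Definition mixture : set T -> \bar R :=
  measure_add (mscale u m1) (mscale s m2).

HB.instance Definition _ := Measure.on mixture.

Let mixture_sigma_finite : sigma_finite setT mixture.
Proof.
have /sigma_finiteP[F [TF ndF Foo]] := sigma_finiteT m1.
have /sigma_finiteP[G [TG ndG Goo]] := sigma_finiteT m2.
exists (fun n => F n `&` G n).
  apply/seteqP; split => // t _.
  have [i _ Fi] : (\bigcup_i F i) t by rewrite -TF.
  have [j _ Gj] : (\bigcup_j G j) t by rewrite -TG.
  exists (maxn i j) => //; split.
  - by move: t Fi {Gj}; exact/subsetPset/ndF/leq_maxl.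
  - by move: t Gj {Fi}; exact/subsetPset/ndG/leq_maxr.
move=> n; have [mF Fn] := Foo n; have [mG Gn] := Goo n.
have mFG : measurable (F n `&` G n) by exact: measurableI.
split => //; rewrite /mixture measure_addE /mscale lte_add_pinfty//.
- rewrite lte_mul_pinfty//; apply: le_lt_trans Fn.
  by apply: le_measure; rewrite ?inE.
- rewrite lte_mul_pinfty//; apply: le_lt_trans Gn.
  by apply: le_measure; rewrite ?inE.
Qed.

HB.instance Definition _ := Measure_isSigmaFinite.Build _ _ _
  mixture mixture_sigma_finite.

End mixture.

Section prior.
Context {R : realType}.

(* The collection (q_{zy} : y in B_1^k), k = m - l(z), is stored as
   ((q_{z0}, q_{z1}), (collection below z0, collection below z1)), so that the
   recursion defining the prior is literally a product of measures. *)
Fixpoint branchings_sig (k : nat) : {d : measure_display & measurableType d} :=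
  if k is k'.+1 then
    let S := projT2 (branchings_sig k') in
    existT (fun d => measurableType d) _
      ((R * R) * (S * S) : measurableType _)%type
  else existT (fun d => measurableType d) _ (unit : measurableType _).

Definition branchings (k : nat) := projT2 (branchings_sig k).

(* The entry q_{zy}; it is meaningful for y of length between 1 and k. *)
Fixpoint branching (k : nat) : branchings k -> bitseq -> R :=
  match k return branchings k -> bitseq -> R with
  | 0 => fun _ _ => 0
  | k'.+1 => fun t y =>
      match y with
      | [::] => 0
      | [:: b] => if b then t.1.2 else t.1.1
      | b :: y' => branching (if b then t.2.2 else t.2.1) y'
      end
  end.

Fixpoint all_half (k : nat) : branchings k :=
  match k return branchings k with
  | 0 => tt
  | k'.+1 => ((2^-1, 2^-1), (all_half k', all_half k'))
  end.

Definition prior_step (alpha : R) (u s : {nonneg R}) {d : measure_display}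
    (S : measurableType d) (half : ((R * R) * (S * S))%type)
    (p0 p1 : {sigma_finite_measure set S -> \bar R}) :
    {sigma_finite_measure set ((R * R) * (S * S))%type -> \bar R} :=
  mixture u s (dirac half)
    (sf_product (beta_measure alpha alpha) (sf_product p0 p1)).

(* p_z depends on z only through k = m - l(z). *)
Fixpoint prior (alpha : R) (u s : {nonneg R}) (k : nat) :
    {sigma_finite_measure set (branchings k) -> \bar R} :=
  match k return {sigma_finite_measure set (branchings k) -> \bar R} with
  | 0 => dirac (tt : branchings 0)
  | k'.+1 => prior_step alpha u s (all_half k'.+1)
               (prior alpha u s k') (prior alpha u s k')
  end.

End prior.

Section evidence.
Context {d : measure_display} {T : measurableType d} {R : realType}.
Variables (m : nat) (cell : bitseq -> set T) (alpha : R) (u s : {nonneg R}).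

(* q_w for w = zy, given the collection (q_{zy})_y *)
Definition branching_at (z : bitseq) (theta : branchings (R := R) (m - size z))
    (w : bitseq) : R :=
  branching theta (drop (size z) w).

Definition evidence (z : bitseq) (E : seq T) : R :=
  \int[prior alpha u s (m - size z)]_theta
    likelihood m cell z (branching_at theta) E.

(* p_z(x | E) *)
Definition predictive (z : bitseq) (E : seq T) (x : T) : R :=
  evidence z (rcons E x) / evidence z E.

End evidence.

Section rates.
Context {R : realType}.

(* f converges to l (resp. diverges to +oo) at least polynomially (resp.
   exponentially) fast in N, with exponent b (resp. rate c). *)
Definition cvg_polynomially (N : nat -> nat) (f : nat -> R) (l b : R) : Prop :=
  f n @[n --> \oo] --> l /\
  exists C : R, \forall n \near \oo, `|f n - l| <= C * (N n)%:R `^ (- b).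

Definition dvg_exponentially (N : nat -> nat) (f : nat -> R) (c : R) : Prop :=
  f n @[n --> \oo] --> +oo /\
  \forall n \near \oo, expR (c * (N n)%:R) <= f n.

End rates.

(* Main.v *)
(** Integrating out the prior one node at a time turns the evidence into a
    function of the cell counts n_w,
      p_z = u + s F(n_z0, n_z1) p_z0 p_z1,
    where F(a, b) is the Beta(alpha, alpha)-integral of (2p)^a (2(1-p))^b.
    Hence p_z(x|D_z) is a convex combination, with weights u / p_z and
    1 - u / p_z, of 1 and 2 (alpha + n_zb) / (2 alpha + n_z) p_zb(x|D_zb),
    where x lies in the child cell zb.

    The data enter only through the fluctuations of n_z0 around q_z0 n_z.  The
    likelihood ratios (1 + t (1 - q_z0))^(n_z0) (1 - t q_z0)^(n_z1) are
    martingales, so Ville's inequality and Borel-Cantelli, applied on the dyadic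
    blocks 2^k <= n_z < 2^(k+1) with t^2 proportional to k / 2^k, give almost
    surely (n_z0 - q_z0 n_z)^2 <= eps n_z ln n_z for large n_z, for any fixed
    eps > 0.  This is stronger than the law of large numbers and is what makes
    F(n_z0, n_z1) decay polynomially when q_z0 = 1/2.  When q_z0 <> 1/2, F grows
    exponentially, whereas F(a, b) never decays exponentially. *)
From HB Require Import structures.
From mathcomp Require Import all_boot all_order all_algebra.
From mathcomp Require Import all_classical all_reals all_analysis.
From mathcomp Require Import measurable_realfun zify ring lra.
Require Import Defs.
Set Implicit Arguments.
Unset Strict Implicit.
Unset Printing Implicit Defensive.
Import Order.TTheory GRing.Theory Num.Theory.
Import numFieldNormedType.Exports.
Local Open Scope classical_set_scope.
Local Open Scope ring_scope.

(** All randomness is confined to one almost sure event, the record [regular_counts]. Past it, every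
    limit is taken along a fixed sequence of counts, so a single null set serves all points x, and
    the rates do not depend on the sample.

    Two effects compete at a node with q_z0 = 1/2 above a non-uniform subtree: F decays while the
    evidence of one child grows exponentially. Growth wins because F and the sibling evidence are at
    least C e^(-x n) for a rate x chosen after the growth rate of that child.

    In the convex combination behind (a), the weight need not converge when the subtree is uniform,
    since both terms then tend to 1; otherwise u / p_z tends to 0. A branch of probability 0 needs
    separate care, because its counts may stay bounded: its factor tends to 0, and the child
    predictive is at most 2^k.

    F is handled by a recursion obtained from integration by parts, and by estimates of its
    integrand that rest on e^(x - 2 x^2) <= 1 + x <= e^(x - x^2 / 6). *)

(** * Quadratic exponential bounds on 1 + x *)

Section exp_bounds.
Context {R : realType}.
Implicit Types x y : R.

(** Squaring [1 + y / 2 <= expR (y / 2)], whose left side is nonnegative by hypothesis. Both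
    quadratic bounds below come from it. *)
Lemma sqr_halved_le_expR y : -2 <= y -> (1 + y / 2) ^+ 2 <= expR y.
Proof.
move=> y2; rewrite [in leRHS](_ : y = y / 2 + y / 2); last by lra.
rewrite expRD -expr2 lerXn2r ?nnegrE ?expR_ge0//; first by lra.
exact: expR_ge1Dx.
Qed.

Lemma le_expR_sub_sqr x : -1 <= x <= 1 -> 1 + x <= expR (x - x ^+ 2 / 6).
Proof.
move=> /andP[x0 x1]; apply: (le_trans _ (sqr_halved_le_expR _)); last by nra.
(* This is [(1 + y / 2) ^+ 2 - (1 + x)] for [y = x - x ^+ 2 / 6]. At [x = 1] the second factor is
   25/144 - 1/6 = 1/144, which is where the constant 6 comes from. *)
suff: 0 <= x ^+ 2 * ((1 - x / 6) ^+ 2 / 4 - 1 / 6) by nra.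
by rewrite mulr_ge0 ?sqr_ge0//; nra.
Qed.

(** Passing to inverses turns the upper bound on [expR] into a lower one, to which the squared bound
    applies. *)
Lemma expR_sub_sqr_le x : -2^-1 <= x <= 2^-1 -> expR (x - 2 * x ^+ 2) <= 1 + x.
Proof.
move=> /andP[x0 x1]; rewrite -[x - _]opprK expRN -[1 + x]invrK lef_pV2 ?posrE ?expR_gt0
  ?invr_gt0//; last by lra.
have h : (1 + (2 * x ^+ 2 - x) / 2) ^+ 2 <= expR (- (x - 2 * x ^+ 2)).
  by rewrite opprB; apply: sqr_halved_le_expR; nra.
apply: le_trans h; rewrite -[leLHS]mul1r ler_pdivrMr; last by lra.
(* The factored form of [(1 + x) * (1 + (2 * x ^+ 2 - x) / 2) ^+ 2 - 1]. *)
suff: 0 <= x ^+ 2 * (5 / 4 + 5 / 4 * x + x ^+ 3) by nra.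
by rewrite mulr_ge0 ?sqr_ge0//; nra.
Qed.
End exp_bounds.

(** * Improper integrals over ]0, 1[ through primitives *)

Section calculus.
Context {R : realType}.
Local Notation leb := (@lebesgue_measure R).

Lemma integral_is_derive (f F : R -> R) (a b : R) : a < b ->
  (forall x, a <= x <= b -> is_derive x 1 F (f x)) ->
  (forall x, a <= x <= b -> {for x, continuous f}) ->
  (\int[leb]_(x in `[a, b]) (f x)%:E = (F b - F a)%:E)%E.
Proof.
move=> ab dF cf; rewrite EFinB; apply: continuous_FTC2 => //.
- by apply: continuous_in_subspaceT => x; rewrite inE/= in_itv/=; exact: cf.
- have cF x : a <= x <= b -> {for x, continuous F}.
    move=> /dF dFx; apply/differentiable_continuous/derivable1_diffP.
    exact: ex_derive.
  split.
  + move=> x /[!in_itv]/= /andP[/ltW ax /ltW xb]; apply: ex_derive.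
    by apply: dF; rewrite ax.
  + by apply/cvg_at_right_filter/cF; rewrite lexx ltW.
  + by apply/cvg_at_left_filter/cF; rewrite lexx ltW.
- move=> x /[!in_itv]/= /andP[/ltW ax /ltW xb]; rewrite derive1E.
  by apply: derive_val; apply: dF; rewrite ax.
Qed.

(** Beta densities may blow up at 0 and 1, so integrals over ]0, 1[ are reached as limits over these
    compact intervals. The shift by 3 keeps the left end below 1/2. *)
Definition shrink (n : nat) : set R := `[n.+3%:R^-1, 1 - n.+3%:R^-1].

Lemma bigcup_shrink : \bigcup_n shrink n = `]0, 1[%classic.
Proof.
apply/seteqP; split => x /=.
  move=> [n _]; rewrite /shrink/= !in_itv/= => /andP[h1 h2].
  have h : 0 < n.+3%:R^-1 :> R by rewrite invr_gt0.
  by move: (n.+3%:R^-1) h h1 h2 => e *; apply/andP; split; lra.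
rewrite in_itv/= => /andP[x0 x1].
pose y := Num.min x (1 - x).
have y0 : 0 < y by rewrite /y lt_min x0 subr_gt0.
pose n := Num.truncn y^-1.
have h : n.+3%:R^-1 <= y.
  rewrite -[leRHS]invrK lef_pV2 ?posrE ?invr_gt0//.
  rewrite ltW// (lt_le_trans (truncnS_gt _))// ler_nat /n.
  by rewrite -addn3 -addn1 leq_add2l.
exists n => //; rewrite /shrink/= in_itv/=.
move: h; rewrite /y le_min => /andP[].
by move: (n.+3%:R^-1) => e *; apply/andP; split => //; lra.
Qed.

Lemma nondecreasing_shrink : nondecreasing_seq shrink.
Proof.
move=> m n mn; apply/subsetPset => x; rewrite /shrink/= !in_itv/= => /andP[h1 h2].
have h : n.+3%:R^-1 <= m.+3%:R^-1 :> R by rewrite lef_pV2 ?posrE// ler_nat.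
by move: n.+3%:R^-1 m.+3%:R^-1 h h1 h2 => e1 e2 *; apply/andP; split; lra.
Qed.

Lemma cvg_integral_shrink (f : R -> R) :
  measurable_fun (`]0, 1[%classic : set R) f -> (forall x : R, 0 < x < 1 -> 0 <= f x) ->
  (\int[leb]_(x in shrink n) (f x)%:E @[n --> \oo] -->
   \int[leb]_(x in `]0%R, 1%R[) (f x)%:E)%E.
Proof.
move=> mf f0; rewrite -bigcup_shrink.
have sub n : shrink n `<=` `]0, 1[ by rewrite -bigcup_shrink; exact: bigcup_sup.
apply: ge0_nondecreasing_set_cvg_integral => //.
- exact: nondecreasing_shrink.
- move=> n; rewrite /shrink; exact: measurable_itv.
- by move=> n; apply/measurable_EFinP; exact: measurable_funS mf.
- by move=> n x /sub/=; rewrite in_itv lee_fin; exact: f0.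
Qed.

Lemma ln_le_sub1 (x : R) : 0 < x -> ln x <= x - 1.
Proof.
by move=> x0; have := expR_ge1Dx (ln x); rewrite lnK ?posrE//; lra.
Qed.

Lemma continuous_powR (a x : R) : 0 < x -> {for x, continuous (@powR R ^~ a)}.
Proof.
move=> x0; apply/differentiable_continuous/derivable1_diffP.
by apply: derivable_powR; rewrite in_itv/= x0.
Qed.

Lemma shrink_itv (n : nat) : let e : R := n.+3%:R^-1 in 0 < e < 2^-1.
Proof. by rewrite /= invr_gt0 ltr0n/= ltf_pV2 ?posrE// ltr_nat. Qed.

(** The integrand may be singular at both ends: the primitive is evaluated only inside the interval,
    and [M + M] bounds each of its increments. *)
Lemma integral_primitive_le (f F : R -> R) (M : R) :
  (forall x : R, 0 < x < 1 -> 0 <= f x) ->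
  (forall x : R, 0 < x < 1 -> is_derive x 1 F (f x)) ->
  (forall x : R, 0 < x < 1 -> {for x, continuous f}) ->
  (forall x : R, 0 < x < 1 -> `|F x| <= M) ->
  (\int[leb]_(x in `]0%R, 1%R[) (f x)%:E <= (M + M)%:E)%E.
Proof.
move=> f0 dF cf FM; have mf : measurable_fun (`]0, 1[%classic : set R) f.
  apply: open_continuous_measurable_fun; first exact: itv_open.
  by move=> x; rewrite inE/= in_itv/=; exact: cf.
have C := cvg_integral_shrink mf f0.
rewrite -(cvg_lim _ C)//; apply: lime_le; first exact: cvgP C.
apply: nearW => n; have := shrink_itv n; rewrite /= /shrink.
move: n.+3%:R^-1 => e /andP[e0 e1].
have -> : (\int[leb]_(x in `[e, (1 - e)%R]) (f x)%:E = (F (1 - e) - F e)%:E)%E.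
  apply: integral_is_derive; first by lra.
  - by move=> x /andP[x1 x2]; apply: dF; apply/andP; split; lra.
  - by move=> x /andP[x1 x2]; apply: cf; apply/andP; split; lra.
have := FM e; have := FM (1 - e); rewrite lee_fin !ler_norml.
by lra.
Qed.

(** Integration by parts with vanishing boundary terms, [f - g] being the derivative of a product.
    Finiteness of both integrals allows the integral of [f - g] to be split. *)
Lemma integral_primitive_eq (f g F : R -> R) :
  (forall x : R, 0 < x < 1 -> 0 <= f x) -> (forall x : R, 0 < x < 1 -> 0 <= g x) ->
  (forall x : R, 0 < x < 1 -> is_derive x 1 F (f x - g x)) ->
  (forall x : R, 0 < x < 1 -> {for x, continuous f}) ->
  (forall x : R, 0 < x < 1 -> {for x, continuous g}) ->
  (\int[leb]_(x in `]0%R, 1%R[) (f x)%:E < +oo)%E ->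
  (\int[leb]_(x in `]0%R, 1%R[) (g x)%:E < +oo)%E ->
  F n.+3%:R^-1 @[n --> \oo] --> 0 -> F (1 - n.+3%:R^-1) @[n --> \oo] --> 0 ->
  (\int[leb]_(x in `]0%R, 1%R[) (f x)%:E = \int[leb]_(x in `]0%R, 1%R[) (g x)%:E)%E.
Proof.
move=> f0 g0 dF cf cg foo goo F0 F1.
have mcts (h : R -> R) : (forall x : R, 0 < x < 1 -> {for x, continuous h}) ->
    measurable_fun (`]0, 1[%classic : set R) h.
  move=> ch; apply: open_continuous_measurable_fun; first exact: itv_open.
  by move=> x; rewrite inE/= in_itv/=; exact: ch.
have [mf mg] := (mcts _ cf, mcts _ cg).
have int (h : R -> R) : measurable_fun (`]0, 1[%classic : set R) h ->
    (forall x : R, 0 < x < 1 -> 0 <= h x) ->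
    (\int[leb]_(x in `]0%R, 1%R[) (h x)%:E < +oo)%E ->
    leb.-integrable `]0, 1[ (EFin \o h).
  move=> mh h0 hoo; apply/integrableP; split; first exact/measurable_EFinP.
  under eq_integral => x do [rewrite inE/= in_itv/= => x01; rewrite ger0_norm ?h0//].
  by [].
have [If Ig] := (int _ mf f0 foo, int _ mg g0 goo).
have sub n : shrink n `<=` `]0, 1[ by rewrite -bigcup_shrink; exact: bigcup_sup.
have intS (h : R -> R) n : leb.-integrable `]0, 1[ (EFin \o h) ->
    leb.-integrable (shrink n) (EFin \o h).
  by apply: integrableS => //; rewrite /shrink; exact: measurable_itv.
have E n : (\int[leb]_(x in shrink n) (f x)%:E =
    \int[leb]_(x in shrink n) (g x)%:E + (F (1 - n.+3%:R^-1) - F n.+3%:R^-1)%:E)%E.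
  have := integralB_EFin _ (intS f n If) (intS g n Ig).
  have -> : (\int[leb]_(x in shrink n) ((f x)%:E - (g x)%:E) =
      (F (1 - n.+3%:R^-1) - F n.+3%:R^-1)%:E)%E.
    have := shrink_itv n; rewrite /= /shrink.
    move: n.+3%:R^-1 => e /andP[e0 e1].
    apply: (@integral_is_derive (fun x => f x - g x)); first by lra.
    - by move=> x /andP[x1 x2]; apply: dF; apply/andP; split; lra.
    - move=> x /andP[x1 x2]; apply: continuousB; [apply: cf|apply: cg];
      by apply/andP; split; lra.
  move=> ->; last by rewrite /shrink; exact: measurable_itv.
  by rewrite addeC subeK// integrable_fin_num//; [rewrite /shrink; exact: measurable_itv|exact: intS].
have Cf := cvg_integral_shrink mf f0.
have Cg := cvg_integral_shrink mg g0.
suff Cf' : (\int[leb]_(x in shrink n) (f x)%:E @[n --> \oo] -->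
    \int[leb]_(x in `]0%R, 1%R[) (g x)%:E)%E by exact: (cvg_unique _ Cf Cf').
under eq_cvg do rewrite E.
rewrite -(adde0 (\int[leb]_(x in `]0%R, 1%R[) (g x)%:E)%E).
apply: cvgeD => //; first by rewrite fin_num_adde_defl.
apply: cvg_EFin; first exact: nearW.
by rewrite -(subrr 0); exact: cvgB.
Qed.
Lemma is_derive_powR_onem (c x : R) : 0 < x < 1 ->
  is_derive x 1 (fun x : R => (1 - x) `^ c) (- (c * (1 - x) `^ (c - 1))).
Proof.
move=> /andP[x0 x1]; have x1' : 0 < 1 - x by lra.
have d1 := is_deriveB (is_derive_cst (1 : R) x 1) (is_derive_id x (1 : R)).
rewrite sub0r in d1.
have := @is_derive1_comp R (@powR R ^~ c) (fun x : R => 1 - x) x _ _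
  (is_derive1_powR c x1') d1.
by rewrite mulrN1.
Qed.

Lemma continuous_powR_onem (c x : R) : 0 < x < 1 ->
  {for x, continuous (fun x : R => (1 - x) `^ c)}.
Proof.
move=> x01; apply/differentiable_continuous/derivable1_diffP.
by have [] := is_derive_powR_onem c x01.
Qed.

Lemma integral_powR_lty (a : R) : 0 < a ->
  (\int[leb]_(x in `]0%R, 1%R[) (x `^ (a - 1))%:E < +oo)%E.
Proof.
move=> a0; apply: (@le_lt_trans _ _ (a^-1 + a^-1)%:E); last exact: ltry.
apply: (@integral_primitive_le _ (fun x => a^-1 * x `^ a)).
- by move=> x _; exact: powR_ge0.
- move=> x /andP[x0 _]; have := is_deriveZ a^-1 (is_derive1_powR a x0).
  by rewrite /GRing.scale/= mulrA mulVf ?mul1r// gt_eqF.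
- by move=> x /andP[x0 _]; exact: continuous_powR.
- move=> x /andP[x0 x1]; rewrite ger0_norm ?mulr_ge0 ?invr_ge0 ?powR_ge0 ?(ltW a0)//.
  rewrite ler_piMr ?invr_ge0 ?(ltW a0)//.
  by rewrite -[leRHS](powRr0 x) ger_powR// ?(ltW a0)// x0 ltW.
Qed.
End calculus.

(** * Finiteness and positivity of the Gamma integral *)

Section Gamma_function.
Context {R : realType}.
Local Notation leb := (@lebesgue_measure R).

(** Split [ln t] at the scale [2 * |c| + 1] and use [ln y <= y - 1]: the remaining slope
    [|c| / (2 * |c| + 1)] is below 1/2, and the scale stays positive when [c = 0]. *)
Lemma powR_mul_expRN_le (c t : R) : 1 <= t ->
  t `^ c <= expR (`|c| * ln (2 * `|c| + 1)) * expR (t / 2).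
Proof.
move=> t1; have t0 : 0 < t by lra.
rewrite /powR gt_eqF// -expRD ler_expR.
apply: (@le_trans _ _ (`|c| * ln t)).
  by rewrite ler_wpM2r ?ln_ge0// ler_norm.
set k := `|c|; have k0 : 0 <= k by rewrite /k.
have l0 : 0 < 2 * k + 1 by lra.
have -> : ln t = ln (2 * k + 1) + ln (t / (2 * k + 1)).
  by rewrite -lnM ?posrE ?divr_gt0// mulrCA divff ?mulr1// gt_eqF.
rewrite mulrDr lerD2l; apply: (@le_trans _ _ (k * (t / (2 * k + 1)))).
  rewrite ler_wpM2l//; have := @ln_le_sub1 _ (t / (2 * k + 1)).
  by rewrite divr_gt0// => /(_ isT); lra.
rewrite mulrA ler_pdivrMr//; nra.
Qed.

Let g (a : R) t := t `^ (a - 1) * expR (- t).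

Let g_ge0 a t : 0 <= g a t.
Proof. by rewrite mulr_ge0 ?powR_ge0 ?expR_ge0. Qed.

Let measurable_g a : measurable_fun [set: R] (g a).
Proof.
apply: measurable_funM; first exact: measurable_powR.
by apply: measurableT_comp => //; exact: measurable_funN.
Qed.

Let integral_g_lty a : 0 < a ->
  (\int[leb]_(t in `]0%R, +oo[) (g a t)%:E < +oo)%E.
Proof.
move=> a0.
have -> : `]0%R, +oo[%classic = `]0%R, 1%R[%classic `|` `[1%R, +oo[%classic :> set R.
  apply/seteqP; split => x/=; rewrite !in_itv/= !andbT.
    by move=> x0; have [?|?] := ltP x 1; [left; rewrite x0|right].
  by move=> [/andP[]//|]; exact: lt_le_trans.
rewrite ge0_integral_setU//; last 3 first.
- by apply: measurable_funTS; apply/measurable_EFinP; exact: measurable_g.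
- by move=> x _; rewrite lee_fin.
- apply/disj_setPS => x [] /=; rewrite !in_itv/= andbT => /andP[_ x1].
  by rewrite leNgt x1.
apply: lte_add_pinfty.
  apply: le_lt_trans (integral_powR_lty a0); apply: ge0_le_integral => //.
  - by move=> x _; rewrite lee_fin.
  - by apply: measurable_funTS; apply/measurable_EFinP; exact: measurable_g.
  - apply: measurable_funTS; apply/measurable_EFinP; exact: measurable_powR.
  - move=> x /=; rewrite in_itv/= => /andP[x0 _].
    by rewrite lee_fin ler_piMr ?powR_ge0// expR_le1; lra.
(* Half of the decay [expR (- t)] absorbs the power; the other half is an exponential density of
   rate 1/2, whose leading factor the 2 cancels. *)
pose C := expR (`|a - 1| * ln (2 * `|a - 1| + 1)) * 2.
have h0 x : 0 <= C * exponential_pdf (2^-1 : R) x.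
  by rewrite !mulr_ge0 ?expR_ge0 ?exponential_pdf_ge0.
have mh : measurable_fun [set: R] (fun x => (C * exponential_pdf (2^-1 : R) x)%:E).
  by apply/measurable_EFinP/measurable_funM => //; exact: measurable_exponential_pdf.
apply: (@le_lt_trans _ _ (\int[leb]_(x in `[1%R, +oo[) (C * exponential_pdf 2^-1 x)%:E)%E).
  apply: ge0_le_integral => //.
  - by move=> x _; rewrite lee_fin.
  - by apply: measurable_funTS; apply/measurable_EFinP; exact: measurable_g.
  - by apply: measurable_funTS; exact: mh.
  - move=> x /=; rewrite in_itv/= andbT => x1; rewrite lee_fin exponential_pdfE; last lra.
    rewrite /C -!mulrA mulVKf// ?pnatr_eq0//.
    rewrite (_ : - 2^-1 * x = x / 2 - x); last lra.
    rewrite expRD mulrA ler_wpM2r ?expR_ge0//; exact: powR_mul_expRN_le.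
apply: (@le_lt_trans _ _ (\int[leb]_x (C * exponential_pdf 2^-1 x)%:E)%E).
  by apply: ge0_subset_integral => // x _; rewrite lee_fin.
under eq_integral do rewrite EFinM.
rewrite ge0_integralZl//.
- by rewrite integral_exponential_pdf// mule1 ltry.
- by apply/measurable_EFinP; exact: measurable_exponential_pdf.
- by move=> x _; rewrite lee_fin exponential_pdf_ge0.
- by rewrite lee_fin mulr_ge0 ?expR_ge0.
Qed.

(** Since [fine] sends an infinite integral to 0, positivity rests on finiteness as well as on a
    lower bound of the integrand. *)
Lemma Gamma_gt0 (a : R) : 0 < a -> 0 < Gamma a.
Proof.
move=> a0; rewrite /Gamma /Rintegral fine_gt0// integral_g_lty// andbT.
(* A crude lower bound of the integrand on [1, 2], where [0 <= ln t <= 1] and [t <= 2]. *)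
pose c := expR (- (2 * `|a - 1| + 2)).
apply: (@lt_le_trans _ _ (\int[leb]_(t in `[1%R, 2%R]) c%:E)%E).
  rewrite integral_cst//= lebesgue_measure_itv/= lte_fin ltrDl ltr01.
  by rewrite -EFinB -EFinM lte_fin mulr_gt0 ?expR_gt0//; lra.
apply: (@le_trans _ _ (\int[leb]_(t in `[1%R, 2%R]) (g a t)%:E)%E).
  apply: ge0_le_integral => //.
  - by move=> x _; rewrite lee_fin expR_ge0.
  - by apply: measurable_funTS; apply/measurable_EFinP; exact: measurable_g.
  - move=> x /=; rewrite in_itv/= => /andP[x1 x2]; rewrite lee_fin /c /g.
    have x0 : 0 < x by lra.
    rewrite /powR gt_eqF// -expRD ler_expR.
    have := ln_le_sub1 x0; have := ln_ge0 x1.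
    have := ler_norm (- (a - 1)); rewrite normrN; have := normr_ge0 (a - 1).
    by nra.
apply: ge0_subset_integral => //.
- by apply: measurable_funTS; apply/measurable_EFinP; exact: measurable_g.
- by move=> x _; rewrite lee_fin.
- by move=> x /=; rewrite !in_itv/= andbT; lra.
Qed.
End Gamma_function.

(** * The Beta integral *)

Definition binary_likelihood {R : realType} (a b : nat) (p : R) : R :=
  (2 * p) ^+ a * (2 * (1 - p)) ^+ b.

Section beta_evidence.
Context {R : realType} (alpha : R).
Hypothesis alpha_gt0 : 0 < alpha.
Local Notation leb := (@lebesgue_measure R).
Local Notation lik := (@binary_likelihood R).
Local Notation dens := (fun p : R => beta_density alpha alpha p (1 - p)).

Definition beta_evidence (a b : nat) : R :=
  \int[leb]_(p in `]0, 1[) (lik a b p * dens p).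

Let K := Gamma (alpha + alpha) / (Gamma alpha * Gamma alpha).

Let K_gt0 : 0 < K.
Proof. by rewrite divr_gt0 ?mulr_gt0 ?Gamma_gt0// addr_gt0. Qed.

Lemma binary_likelihood_ge0 a b (p : R) : 0 < p < 1 -> 0 <= lik a b p.
Proof. by move=> /andP[p0 p1]; rewrite mulr_ge0// exprn_ge0//; lra. Qed.

Lemma binary_likelihood_le a b (p : R) : 0 < p < 1 -> lik a b p <= 2 ^+ (a + b).
Proof.
move=> /andP[p0 p1]; rewrite exprD; apply: ler_pM; rewrite ?exprn_ge0//; try lra.
  by apply: lerXn2r; rewrite ?nnegrE; lra.
by apply: lerXn2r; rewrite ?nnegrE; lra.
Qed.

Let powR_le01 (c p : R) : 0 <= c -> 0 < p < 1 -> p `^ c <= 1.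
Proof.
by move=> c0 /andP[p0 p1]; rewrite -[leRHS](powRr0 p) ger_powR// p0 ltW.
Qed.

(** On each half of ]0, 1[ one of the two powers is at most [2 ^ |alpha - 1|], so the density is
    dominated by a multiple of their sum [h], which has an explicit bounded primitive. *)
Lemma integral_beta_density_lty :
  (\int[leb]_(p in `]0%R, 1%R[) (dens p)%:E < +oo)%E.
Proof.
pose h p : R := p `^ (alpha - 1) + (1 - p) `^ (alpha - 1).
pose M : R := K * 2 `^ `|alpha - 1|.
have M0 : 0 <= M by rewrite mulr_ge0 ?powR_ge0// ltW.
have mh : measurable_fun (`]0, 1[%classic : set R) h.
  apply: measurable_funTS; apply: measurable_funD; first exact: measurable_powR.
  by apply: (measurableT_comp (measurable_powR _)); exact: measurable_funB.
have h0 p : 0 <= h p by rewrite addr_ge0 ?powR_ge0.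
apply: (@le_lt_trans _ _ (\int[leb]_(p in `]0%R, 1%R[) (M%:E * (h p)%:E))%E).
  apply: ge0_le_integral => //.
  - by move=> p _; rewrite lee_fin beta_density_ge0.
  - by apply/measurable_funTS/measurable_EFinP; exact: measurable_beta_density.
  - by apply: measurable_funeM; exact/measurable_EFinP.
  - move=> p /=; rewrite in_itv/= => /andP[p0 p1].
    rewrite lee_fin /beta_density -/K /M -(mulrA K) -(mulrA K) ler_wpM2l ?(ltW K_gt0)//.
    have H (q : R) : 2^-1 <= q < 1 -> q `^ (alpha - 1) <= 2 `^ `|alpha - 1|.
      move=> /andP[q0 q1]; rewrite /powR !gt_eqF//; last lra.
      rewrite ler_expR; apply: (@le_trans _ _ (`|alpha - 1| * - ln q)).
        rewrite -[leLHS]mulrNN ler_wpM2r// ?oppr_ge0 ?ln_le0 ?(ltW q1)//.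
        by rewrite -normrN ler_norm.
      have q00 : 0 < q by lra.
      by rewrite ler_wpM2l// -lnV ?posrE// ler_ln ?posrE ?invr_gt0// -[leRHS]invrK lef_pV2 ?posrE ?invr_gt0.
    rewrite /h; set x := p `^ (alpha - 1); set y := (1 - p) `^ (alpha - 1).
    set c := 2 `^ `|alpha - 1|.
    have [x0 y0] : 0 <= x /\ 0 <= y by rewrite !powR_ge0.
    have [hp|hp] := leP 2^-1 p.
      have xc : x <= c by apply: H; rewrite hp.
      by rewrite mulrDr ler_wpDl ?ler_wpM2r// mulr_ge0// (le_trans x0).
    have yc : y <= c by apply: H; apply/andP; split; lra.
    by rewrite mulrDr mulrC ler_wpDr ?ler_wpM2r// mulr_ge0// (le_trans y0).
rewrite ge0_integralZl//; last first.
- by move=> p _; rewrite lee_fin.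
- exact/measurable_EFinP.
rewrite lte_mul_pinfty ?lee_fin//.
apply: (@le_lt_trans _ _ (alpha^-1 + alpha^-1)%:E); last exact: ltry.
apply: (@integral_primitive_le _ _ (fun p => alpha^-1 * (p `^ alpha - (1 - p) `^ alpha))).
- by [].
- move=> p p01; have /andP[p0 p1] := p01.
  have := is_deriveZ alpha^-1 (is_deriveB (is_derive1_powR alpha p0) (is_derive_powR_onem alpha p01)).
  by rewrite /GRing.scale/= opprK -mulrDr mulrA mulVf ?mul1r// gt_eqF.
- move=> p /andP[p0 p1]; apply: continuousD; first exact: continuous_powR.
  by apply: continuous_powR_onem; rewrite p0.
- move=> p p01; rewrite normrM ger0_norm ?invr_ge0 ?(ltW alpha_gt0)//.
  rewrite ler_piMr ?invr_ge0 ?(ltW alpha_gt0)// ler_norml.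
  have := powR_le01 (ltW alpha_gt0) p01.
  have : (1 - p) `^ alpha <= 1.
    by apply: powR_le01; [exact: ltW|case/andP: p01 => *; apply/andP; split; lra].
  by have := powR_ge0 p alpha; have := powR_ge0 (1 - p) alpha; lra.
Qed.

Lemma measurable_binary_likelihood a b : measurable_fun [set: R] (lik a b).
Proof.
by apply: measurable_funM; apply: measurable_funX; apply: measurable_funM => //;
  exact: measurable_funB.
Qed.

Lemma measurable_beta_evidence a b :
  measurable_fun [set: R] (fun p => lik a b p * dens p).
Proof.
apply: measurable_funM; first exact: measurable_binary_likelihood.
exact: measurable_beta_density.
Qed.

Lemma integrable_beta_evidence a b :
  leb.-integrable `]0, 1[ (fun p => (lik a b p * dens p)%:E).
Proof.
apply/integrableP; split.
  by apply: measurable_funTS; apply/measurable_EFinP; exact: measurable_beta_evidence.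
apply: (@le_lt_trans _ _ (\int[leb]_(p in `]0%R, 1%R[) ((2 ^+ (a + b))%:E * (dens p)%:E))%E).
  apply: ge0_le_integral => //.
  - apply: measurable_funTS; apply: measurableT_comp => //; apply/measurable_EFinP.
    exact: measurable_beta_evidence.
  - apply: measurable_funTS; apply: measurable_funeM; apply/measurable_EFinP.
    exact: measurable_beta_density.
  - move=> p /=; rewrite in_itv/= => p01; rewrite lee_fin ger0_norm.
      by rewrite ler_wpM2r ?beta_density_ge0 ?binary_likelihood_le.
    by rewrite mulr_ge0 ?beta_density_ge0 ?binary_likelihood_ge0.
rewrite ge0_integralZl//.
- by rewrite lte_mul_pinfty ?lee_fin ?exprn_ge0// integral_beta_density_lty.
- by apply: measurable_funTS; apply/measurable_EFinP; exact: measurable_beta_density.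
- by move=> p _; rewrite lee_fin beta_density_ge0.
Qed.

Lemma EFin_beta_evidence a b : (beta_evidence a b)%:E =
  (\int[leb]_(p in `]0%R, 1%R[) (lik a b p * dens p)%:E)%E.
Proof. by rewrite fineK//; apply: integrable_fin_num => //; exact: integrable_beta_evidence. Qed.

End beta_evidence.

(** * The recursion of F in its two counts *)

Section beta_evidence_recursion.
Context {R : realType} (alpha : R).
Hypothesis alpha_gt0 : 0 < alpha.
Local Notation leb := (@lebesgue_measure R).
Local Notation lik := (@binary_likelihood R).
Local Notation dens := (fun p : R => beta_density alpha alpha p (1 - p)).
Local Notation bev := (beta_evidence alpha).

Lemma cvg_powR_invn (c : R) : 0 < c -> (n.+3%:R^-1 : R) `^ c @[n --> \oo] --> (0 : R).
Proof.
move=> c0; have /cvg_at_rightP := @powR_cvg0 R c c0; apply; split.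
  by move=> n; rewrite invr_gt0.
have := @cvg_harmonic R; rewrite -(cvg_shiftn 2).
by apply: cvg_trans; apply: near_eq_cvg; apply: nearW => n; rewrite /harmonic/= addn2.
Qed.

Let K := Gamma (alpha + alpha) / (Gamma alpha * Gamma alpha).

(** Conjugacy: observations only shift the two exponents of the Beta density. *)
Let beta_evidence_density a b (p : R) : 0 < p < 1 -> lik a b p * dens p =
  2 ^+ (a + b) * K * (p `^ (alpha + a%:R - 1) * (1 - p) `^ (alpha + b%:R - 1)).
Proof.
move=> /andP[p0 p1]; rewrite /binary_likelihood /beta_density -/K !exprMn exprD.
have q0 : 0 < 1 - p by lra.
rewrite !(addrAC alpha _ (-1)) !powRD ?(gt_eqF p0) ?(gt_eqF q0) ?implybT//.
by rewrite !powR_mulrn ?ltW//; ring.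
Qed.

Let continuous_beta_evidence_density a b (p : R) : 0 < p < 1 ->
  {for p, continuous (fun p => lik a b p * dens p)}.
Proof.
move=> p01; have /andP[p0 p1] := p01.
have c1 : {for p, continuous (fun p : R => 1 - p)}.
  by apply: continuousB => //; exact: cst_continuous.
have cX (h : R -> R) n : {for p, continuous h} -> {for p, continuous (fun x => h x ^+ n)}.
  by move=> ch; apply: (@continuous_comp _ _ _ h (fun y => y ^+ n)) => //; exact: exprn_continuous.
apply: continuousM.
  apply: continuousM; apply: cX; apply: continuousM => //; exact: cst_continuous.
apply: continuousM.
  by apply: continuousM; [exact: cst_continuous|exact: continuous_powR].
exact: continuous_powR_onem.
Qed.

(* Integration by parts with p^(alpha+a) (1-p)^(alpha+b), which vanishes at 0 and 1;
   no normalisation of the Beta density is involved. *)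
Lemma beta_evidence_by_parts a b :
  (alpha + a%:R) * bev a b.+1 = (alpha + b%:R) * bev a.+1 b.
Proof.
set A := alpha + a%:R; set B := alpha + b%:R.
have A0 : 0 < A by rewrite ltr_pwDl.
have B0 : 0 < B by rewrite ltr_pwDl.
pose c := 2 ^+ (a + b).+1 * K.
(* Both integrands carry [a + b + 1] observations, hence the same power of 2 in [c]. *)
pose F := c \*: ((@powR R ^~ A) * (fun p => (1 - p) `^ B)).
have FE p : F p = c * (p `^ A * (1 - p) `^ B) by [].
have c0 : 0 <= c by rewrite mulr_ge0 ?exprn_ge0// divr_ge0 ?mulr_ge0 ?Gamma_ge0.
have E k h (k0 : 0 <= k) i j : h = (fun p : R => k * (lik i j p * dens p)) ->
    (k * bev i j)%:E = (\int[leb]_(p in `]0%R, 1%R[) (h p)%:E)%E.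
  move=> ->; rewrite EFinM EFin_beta_evidence// -ge0_integralZl//.
  - by apply: measurable_funTS; apply/measurable_EFinP; exact: measurable_beta_evidence.
  - move=> p /=; rewrite in_itv/= => p01.
    by rewrite lee_fin; apply: mulr_ge0; [exact: binary_likelihood_ge0|exact: beta_density_ge0].
have ge0 k i j p : 0 <= k -> 0 < p < 1 -> 0 <= k * (lik i j p * dens p).
  by move=> k0 p01; apply: mulr_ge0 => //; apply: mulr_ge0;
    [exact: binary_likelihood_ge0|exact: beta_density_ge0].
apply/EFin_inj.
rewrite (E _ _ (ltW A0) _ _ erefl) (E _ _ (ltW B0) _ _ erefl).
apply: (@integral_primitive_eq _ _ _ F).
- by move=> p; apply: ge0; exact: ltW.
- by move=> p; apply: ge0; exact: ltW.
- move=> p p01; have /andP[p0 p1] := p01.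
  have q0 : 0 < 1 - p by lra.
  have dF : is_derive p 1 F (c *: (p `^ A *: (- (B * (1 - p) `^ (B - 1))) +
      (1 - p) `^ B *: (A * p `^ (A - 1)))).
    exact: is_deriveZ (is_deriveM (is_derive1_powR A p0) (is_derive_powR_onem B p01)).
  suff -> : A * (lik a b.+1 p * dens p) - B * (lik a.+1 b p * dens p) =
     c * (p `^ A * (- (B * (1 - p) `^ (B - 1))) + (1 - p) `^ B * (A * p `^ (A - 1))) by [].
  rewrite !beta_evidence_density// !addSn !addnS.
  rewrite -/c -!natr1 !addrA -/A -/B !addrK; ring.
- move=> p p01; apply: continuousM; first exact: cst_continuous.
  exact: continuous_beta_evidence_density.
- move=> p p01; apply: continuousM; first exact: cst_continuous.
  exact: continuous_beta_evidence_density.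
- by rewrite -(E _ _ (ltW A0) _ _ erefl) ltry.
- by rewrite -(E _ _ (ltW B0) _ _ erefl) ltry.
- have le1 n : (1 - n.+3%:R^-1 : R) `^ B <= 1.
    have := shrink_itv (R := R) n; rewrite /=; move: n.+3%:R^-1 => e /andP[e0 e1].
    by rewrite -[leRHS](powRr0 (1 - e)) ger_powR// ?(ltW B0)//; apply/andP; split; lra.
  apply: (@squeeze_cvgr _ _ _ _ (fun=> 0) (fun n => c * (n.+3%:R^-1 `^ A))).
  + apply: nearW => n /=; rewrite FE; apply/andP; split.
      by apply: mulr_ge0 => //; apply: mulr_ge0; exact: powR_ge0.
    rewrite ler_wpM2l//.
    by rewrite ler_piMr ?powR_ge0.
  + exact: cvg_cst.
  + by rewrite -[X in _ --> X](mulr0 c); apply: cvgMr; exact: cvg_powR_invn.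
- have le1 n : (1 - n.+3%:R^-1 : R) `^ A <= 1.
    have := shrink_itv (R := R) n; rewrite /=; move: n.+3%:R^-1 => e /andP[e0 e1].
    by rewrite -[leRHS](powRr0 (1 - e)) ger_powR// ?(ltW A0)//; apply/andP; split; lra.
  apply: (@squeeze_cvgr _ _ _ _ (fun=> 0) (fun n => c * (n.+3%:R^-1 `^ B))).
  + apply: nearW => n /=; rewrite FE subKr; apply/andP; split.
      by apply: mulr_ge0 => //; apply: mulr_ge0; exact: powR_ge0.
    rewrite ler_wpM2l//.
    by rewrite ler_piMl ?powR_ge0.
  + exact: cvg_cst.
  + by rewrite -[X in _ --> X](mulr0 c); apply: cvgMr; exact: cvg_powR_invn.
Qed.

(** [2 p + 2 (1 - p) = 2] under the integral sign. *)
Lemma beta_evidenceD a b : bev a.+1 b + bev a b.+1 = 2 * bev a b.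
Proof.
rewrite /beta_evidence -RintegralZl//; last exact: integrable_beta_evidence.
rewrite -RintegralD//; try exact: integrable_beta_evidence.
apply: eq_Rintegral => p _; rewrite /binary_likelihood !exprS; ring.
Qed.

(** The two preceding relations are linear in the two successors of F(a, b); solving them gives
    twice the rule of succession [(alpha + a) / (2 alpha + a + b)]. *)
Lemma beta_evidenceSl a b :
  (2 * alpha + (a + b)%:R) * bev a.+1 b = 2 * (alpha + a%:R) * bev a b.
Proof.
have := beta_evidence_by_parts a b; have := beta_evidenceD a b.
rewrite natrD => h1 h2; have -> : bev a b = (bev a.+1 b + bev a b.+1) / 2 by rewrite h1; field.
rewrite [RHS](_ : _ = (alpha + a%:R) * bev a.+1 b + (alpha + a%:R) * bev a b.+1); last by field.
rewrite h2; ring.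
Qed.

Lemma beta_evidenceSr a b :
  (2 * alpha + (a + b)%:R) * bev a b.+1 = 2 * (alpha + b%:R) * bev a b.
Proof.
have h1 := beta_evidenceSl a b; have h2 := beta_evidenceD a b.
have -> : bev a b.+1 = 2 * bev a b - bev a.+1 b by rewrite -h2; ring.
by rewrite mulrBr h1 natrD; ring.
Qed.

End beta_evidence_recursion.

(** * Bounds on F from windows of p *)

Section beta_evidence_bounds.
Context {R : realType} (alpha : R).
Hypothesis alpha_gt0 : 0 < alpha.
Local Notation leb := (@lebesgue_measure R).
Local Notation lik := (@binary_likelihood R).
Local Notation dens := (fun p : R => beta_density alpha alpha p (1 - p)).
Local Notation bev := (beta_evidence alpha).

Lemma beta_densityE : exists2 K : R, 0 < K &
  forall p, dens p = K * (p `^ (alpha - 1) * (1 - p) `^ (alpha - 1)).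
Proof.
exists (Gamma (alpha + alpha) / (Gamma alpha * Gamma alpha)).
  by rewrite divr_gt0 ?mulr_gt0 ?Gamma_gt0// addr_gt0.
by move=> p; rewrite /beta_density -!mulrA.
Qed.

(** The absolute value treats both signs of the exponent [alpha - 1] at once. *)
Lemma powR_norm_le (c y q : R) : 0 < y -> y <= q <= 1 ->
  y `^ `|c| <= q `^ c <= y `^ (- `|c|).
Proof.
move=> y0 /andP[yq q1]; have q0 : 0 < q by lra.
rewrite /powR !gt_eqF// !ler_expR.
have l1 : ln y <= ln q by rewrite ler_ln.
have l2 : ln q <= 0 by exact: ln_le0.
have := ler_norm c; have := ler_norm (- c); rewrite normrN => c1 c2.
have : `|c| * ln y <= `|c| * ln q by rewrite ler_wpM2l.
by move=> h; apply/andP; split; nra.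
Qed.

Lemma beta_density_bounds (y : R) : 0 < y ->
  exists2 c : R, 0 < c & exists2 C : R, 0 < C &
  forall p : R, y <= p <= 1 - y -> c <= dens p <= C.
Proof.
move=> y0; have [K K0 KE] := beta_densityE.
exists (K * (y `^ `|alpha - 1| * y `^ `|alpha - 1|)).
  by rewrite !mulr_gt0 ?powR_gt0.
exists (K * (y `^ (- `|alpha - 1|) * y `^ (- `|alpha - 1|))).
  by rewrite !mulr_gt0 ?powR_gt0.
move=> p /andP[p1 p2].
have /andP[a1 a2] : y `^ `|alpha - 1| <= p `^ (alpha - 1) <= y `^ (- `|alpha - 1|).
  by apply: powR_norm_le => //; apply/andP; split; lra.
have /andP[b1 b2] : y `^ `|alpha - 1| <= (1 - p) `^ (alpha - 1) <= y `^ (- `|alpha - 1|).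
  by apply: powR_norm_le => //; apply/andP; split; lra.
rewrite KE !ler_pM2l//; apply/andP; split;
  by apply: ler_pM => //; exact: powR_ge0.
Qed.

(** Only the window [[x, y]] is kept, where the density is bounded below; the constant depends on
    the window but not on the counts. *)
Lemma beta_evidence_ge (x y : R) : 0 < x -> x < y -> y < 1 ->
  exists2 c : R, 0 < c & forall a b v, 0 <= v ->
    (forall p, x <= p <= y -> v <= lik a b p) -> c * v <= bev a b.
Proof.
move=> x0 xy y1; pose z := Num.min x (1 - y).
have z0 : 0 < z by rewrite /z lt_min x0 subr_gt0.
have [c c0 [C _ cd]] := beta_density_bounds z0.
exists (c * (y - x)); first by rewrite mulr_gt0// subr_gt0.
move=> a b v v0 hv; rewrite -lee_fin EFin_beta_evidence//.
have sub : (`[x, y]%classic : set R) `<=` `]0, 1[.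
  by move=> p /=; rewrite !in_itv/= => /andP[? ?]; apply/andP; split; lra.
apply: (@le_trans _ _ (\int[leb]_(p in `[x, y]) (c * v)%:E)%E).
  rewrite integral_cst//= lebesgue_measure_itv/= lte_fin xy -EFinB -EFinM lee_fin.
  by rewrite mulrAC.
apply: (@le_trans _ _ (\int[leb]_(p in `[x, y]) (lik a b p * dens p)%:E)%E).
  apply: ge0_le_integral => //.
  - by move=> p _; rewrite lee_fin mulr_ge0// ltW.
  - by apply: measurable_funTS; apply/measurable_EFinP; exact: measurable_beta_evidence.
  - move=> p /=; rewrite in_itv/= => pxy; rewrite lee_fin mulrC.
    apply: ler_pM => //; [exact: ltW|exact: hv|].
    have /andP[//] : c <= dens p <= C.
    move: pxy => /andP[p1 p2]; apply: cd.
    have [zx zy] : z <= x /\ z <= 1 - y by rewrite /z !ge_min !lexx orbT.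
    by apply/andP; split; lra.
apply: ge0_subset_integral => //.
- by apply: measurable_funTS; apply/measurable_EFinP; exact: measurable_beta_evidence.
- move=> p /=; rewrite in_itv/= => p01; rewrite lee_fin.
  by apply: mulr_ge0; [exact: binary_likelihood_ge0|exact: beta_density_ge0].
Qed.

(** The window [|2 p - 1| <= r] has length [r] and, as [r <= 1/2], stays in [1/4, 3/4], where the
    density is bounded: this gives [r * v]. The complement gives [w]. *)
Lemma beta_evidence_le : exists2 C : R, 0 < C & forall a b r v w,
  0 < r -> r <= 2^-1 -> 0 <= v -> 0 <= w ->
  (forall p, 0 < p < 1 -> lik a b p <= v) ->
  (forall p, 0 < p < 1 -> r < `|2 * p - 1| -> lik a b p <= w) ->
  bev a b <= C * (r * v + w).
Proof.
have [c1 _ [C1 C10 hC1]] : exists2 c : R, 0 < c & exists2 C : R, 0 < C &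
  forall p : R, 4^-1 <= p <= 1 - 4^-1 -> c <= dens p <= C.
  by apply: beta_density_bounds; rewrite invr_gt0.
pose M := bev 0 0.
have M0 : 0 <= M.
  apply: Rintegral_ge0 => p; rewrite /= in_itv/= => p01.
  by apply: mulr_ge0; [exact: binary_likelihood_ge0|exact: beta_density_ge0].
exists (C1 + M); first lra.
move=> a b r v w r0 r1 v0 w0 hv hw; rewrite -lee_fin EFin_beta_evidence//.
pose A : set R := `[(1 - r) / 2, (1 + r) / 2]%classic.
have mA : measurable A by exact: measurable_itv.
have AI p : A p -> 0 < p < 1 by rewrite /A/= in_itv/= => /andP[? ?]; apply/andP; split; lra.
have mf : measurable_fun [set: R] (fun p => (lik a b p * dens p)%:E).
  by apply/measurable_EFinP; exact: measurable_beta_evidence.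
have fge0 p : 0 < p < 1 -> (0 <= (lik a b p * dens p)%:E)%E.
  move=> p01; rewrite lee_fin.
  by apply: mulr_ge0; [exact: binary_likelihood_ge0|exact: beta_density_ge0].
have -> : (`]0%R, 1%R[%classic : set R) = A `|` (`]0%R, 1%R[%classic `\` A).
  apply/seteqP; split => p.
    by move=> pI; have [?|?] := pselect (A p); [left|right].
  by move=> [/AI|[]]//=; rewrite in_itv.
rewrite ge0_integral_setU//; last 4 first.
- by apply: measurableD => //; exact: measurable_itv.
- exact: measurable_funTS.
- by move=> p [/AI|[/=]]; rewrite ?in_itv/= => p01; [exact: fge0|move=> _; exact: fge0].
- by apply/disj_setPS => p [? []].
rewrite (_ : (C1 + M) * (r * v + w) = C1 * (r * v) + M * w + (C1 * w + M * (r * v))); last by ring.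
rewrite EFinD; apply: (@le_trans _ _ (C1 * (r * v) + M * w)%:E); last first.
  by rewrite -EFinD lee_fin lerDl addr_ge0// mulr_ge0 ?mulr_ge0// ltW.
rewrite EFinD; apply: leeD.
  apply: (@le_trans _ _ (\int[leb]_(p in A) (C1 * v)%:E)%E).
    apply: ge0_le_integral => //.
    - by move=> p /AI; exact: fge0.
    - exact: measurable_funTS.
    - move=> p Ap; rewrite lee_fin mulrC; apply: ler_pM.
      + exact: beta_density_ge0.
      + by apply: binary_likelihood_ge0; exact: AI.
      + have /andP[//] : c1 <= dens p <= C1.
        apply: hC1.
        by move: Ap; rewrite /A/= in_itv/= => /andP[? ?]; apply/andP; split; lra.
      + by apply: hv; exact: AI.
  rewrite integral_cst//= lebesgue_measure_itv/= lte_fin ifT; last lra.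
  rewrite -EFinB -EFinM lee_fin.
  rewrite (_ : (1 + r) / 2 - (1 - r) / 2 = r); last by field.
  by rewrite -mulrA (mulrC v).
(* Off the window the density may be unbounded, so [w] is multiplied by its total mass, written as
   F(0, 0). *)
have m0 : measurable_fun [set: R] (fun p => (w%:E * (lik 0 0 p * dens p)%:E)%E).
  by apply: measurable_funeM; apply/measurable_EFinP; exact: measurable_beta_evidence.
have g0 p : 0 < p < 1 -> (0 <= w%:E * (lik 0 0 p * dens p)%:E)%E.
  move=> p01; rewrite mule_ge0 ?lee_fin//.
  by apply: mulr_ge0; [exact: binary_likelihood_ge0|exact: beta_density_ge0].
have mD : measurable ((`]0%R, 1%R[%classic : set R) `\` A).
  by apply: measurableD => //; exact: measurable_itv.
apply: (@le_trans _ _ (\int[leb]_(p in `]0%R, 1%R[) (w%:E * (lik 0 0 p * dens p)%:E))%E).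
  apply: (@le_trans _ _ (\int[leb]_(p in `]0%R, 1%R[%classic `\` A) (w%:E * (lik 0 0 p * dens p)%:E))%E).
    apply: ge0_le_integral => //.
    - by move=> p []/=; rewrite in_itv/= => p01 _; exact: fge0.
    - exact: measurable_funTS.
    - exact: measurable_funTS.
    - move=> p []/=; rewrite in_itv/= => p01 Ap.
      rewrite -EFinM lee_fin {2}/binary_likelihood !expr0 mulr1 mul1r.
      apply: ler_wpM2r; first exact: beta_density_ge0.
      apply: hw => //; rewrite ltNge; apply/negP => h; apply: Ap.
      move: h; rewrite /A/= in_itv/= ler_norml => /andP[? ?].
      by apply/andP; split; lra.
  by apply: ge0_subset_integral => //; exact: measurable_funTS.
rewrite ge0_integralZl//.
- by rewrite -EFin_beta_evidence// -EFinM lee_fin mulrC.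
- by apply: measurable_funTS; apply/measurable_EFinP; exact: measurable_beta_evidence.
- move=> p /=; rewrite in_itv/= => p01; rewrite lee_fin.
  by apply: mulr_ge0; [exact: binary_likelihood_ge0|exact: beta_density_ge0].
Qed.
End beta_evidence_bounds.

(** * Growth and decay of F *)

Section beta_evidence_asymptotics.
Context {R : realType} (alpha : R).
Hypothesis alpha_gt0 : 0 < alpha.
Local Notation lik := (@binary_likelihood R).
Local Notation bev := (beta_evidence alpha).

Lemma binary_likelihoodE a b (p : R) :
  lik a b p = (1 + (2 * p - 1)) ^+ a * (1 - (2 * p - 1)) ^+ b.
Proof. by rewrite /binary_likelihood; congr (_ ^+ _ * _ ^+ _); ring. Qed.

(** Gaussian domination: the linear term sees only the imbalance [a - b], the penalty sees the full
    count [a + b]. *)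
Lemma binary_likelihood_le_expR a b (p : R) : 0 < p < 1 ->
  lik a b p <= expR ((a%:R - b%:R) * (2 * p - 1) - (a + b)%:R * (2 * p - 1) ^+ 2 / 6).
Proof.
move=> /andP[p0 p1]; rewrite binary_likelihoodE; set x := 2 * p - 1.
have x1 : -1 <= x <= 1 by rewrite /x; apply/andP; split; lra.
have x2 : -1 <= - x <= 1 by rewrite /x; apply/andP; split; lra.
have -> : (a%:R - b%:R) * x - (a + b)%:R * x ^+ 2 / 6 =
    a%:R * (x - x ^+ 2 / 6) + b%:R * (- x - (- x) ^+ 2 / 6) by rewrite natrD; ring.
rewrite expRD !expRM_natl; apply: ler_pM; rewrite ?exprn_ge0 ?/x//; try lra.
  by apply: lerXn2r; rewrite ?nnegrE ?expR_ge0 ?le_expR_sub_sqr//; move: x1; lra.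
by apply: lerXn2r; rewrite ?nnegrE ?expR_ge0 ?le_expR_sub_sqr//; move: x1; lra.
Qed.

Lemma expR_le_binary_likelihood a b (p : R) : 4^-1 <= p <= 3 / 4 ->
  expR ((a%:R - b%:R) * (2 * p - 1) - 2 * (a + b)%:R * (2 * p - 1) ^+ 2) <= lik a b p.
Proof.
move=> /andP[p0 p1]; rewrite binary_likelihoodE; set x := 2 * p - 1.
have x1 : -2^-1 <= x <= 2^-1 by rewrite /x; apply/andP; split; lra.
have x2 : -2^-1 <= - x <= 2^-1 by rewrite /x; apply/andP; split; lra.
have -> : (a%:R - b%:R) * x - 2 * (a + b)%:R * x ^+ 2 =
    a%:R * (x - 2 * x ^+ 2) + b%:R * (- x - 2 * (- x) ^+ 2) by rewrite natrD; ring.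
rewrite expRD !expRM_natl; apply: ler_pM; rewrite ?exprn_ge0 ?expR_ge0//.
  by apply: lerXn2r; rewrite ?nnegrE ?expR_ge0 ?expR_sub_sqr_le//; move: x1; lra.
by apply: lerXn2r; rewrite ?nnegrE ?expR_ge0 ?expR_sub_sqr_le//; move: x1; lra.
Qed.

(** For [p] within [e / 2] of 1/2, both [2 p] and [2 (1 - p)] are at least [1 - e], whatever the
    counts. *)
Lemma beta_evidence_ge_expn (e : R) : 0 < e < 1 -> exists2 c : R, 0 < c &
  forall a b, c * (1 - e) ^+ (a + b) <= bev a b.
Proof.
move=> /andP[e0 e1].
have [|||c c0 h] := @beta_evidence_ge R alpha alpha_gt0 ((1 - e) / 2) ((1 + e) / 2); try lra.
exists c => // a b; apply: h; first by rewrite exprn_ge0//; lra.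
move=> p /andP[p1 p2]; rewrite exprD; apply: ler_pM; rewrite ?exprn_ge0//; try lra;
 by apply: lerXn2r; rewrite ?nnegrE; lra.
Qed.

Lemma beta_evidence_gt0 a b : 0 < bev a b.
Proof.
have [|c c0 h] := @beta_evidence_ge_expn 2^-1; first by apply/andP; split; lra.
by apply: lt_le_trans (h a b); rewrite mulr_gt0// exprn_gt0//; lra.
Qed.

(** With [r = 2 q - 1], the imbalance [a - b] has the sign of [r] and size at least
    [3/4 |r| (a + b)]. The window lies near 1/2 on the side of [q], since the quadratic lower bound
    needs [p] in [1/4, 3/4] while [q] may be 0 or 1. It gives [x = 2 p - 1] size between [|r| / 8]
    and [|r| / 4], so the exponent is at least [|r| / 8] times [|r| / 4] times [a + b]: hence 32. *)
Lemma beta_evidence_ge_expR (q : R) : 0 <= q <= 1 -> q != 2^-1 ->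
  exists2 c : R, 0 < c & forall a b,
    `|a%:R - q * (a + b)%:R| <= `|2 * q - 1| / 8 * (a + b)%:R ->
    c * expR ((a + b)%:R * (2 * q - 1) ^+ 2 / 32) <= bev a b.
Proof.
move=> /andP[q0 q1] q2; set r := 2 * q - 1.
have rr : -1 <= r <= 1 by rewrite /r; apply/andP; split; lra.
have := q2; rewrite neq_lt => /orP[] hq.
- have r0 : r < 0 by rewrite /r; lra.
  have [|||c c0 h] := @beta_evidence_ge R alpha alpha_gt0 (2^-1 + r / 8) (2^-1 + r / 16); try lra.
  exists c => // a b hab; apply: h; first exact: expR_ge0.
  move=> p /andP[p1 p2]; apply: le_trans (expR_le_binary_likelihood _ _ _); last first.
    by apply/andP; split; lra.
  rewrite ler_expR; move: hab; rewrite (ltr0_norm r0) natrD.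
  set x := 2 * p - 1; set A := a%:R; set B := b%:R.
  have A0 : 0 <= A by []. have B0 : 0 <= B by [].
  rewrite ler_norml => /andP[h1 h2].
  have qE : q = (r + 1) / 2 by rewrite /r; lra.
  have S : A - B <= 3 / 4 * r * (A + B) by move: h2; rewrite qE; nra.
  have x1 : r / 4 <= x by rewrite /x; lra.
  have x2 : x <= r / 8 by rewrite /x; lra.
  have -> : (A - B) * x - 2 * (A + B) * x ^+ 2 = (- x) * (2 * (A + B) * x - (A - B)) by ring.
  apply: (@le_trans _ _ (- x * (- r / 4 * (A + B)))).
    have -> : (A + B) * r ^+ 2 / 32 = - (r / 8) * (- r / 4 * (A + B)) by field.
    apply: ler_wpM2r; last lra.
    by apply: mulr_ge0; lra.
  rewrite ler_wpM2l//; first lra.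
  have : r / 4 * (A + B) <= x * (A + B) by rewrite ler_wpM2r// addr_ge0.
  by lra.
- have r0 : 0 < r by rewrite /r; lra.
  have [|||c c0 h] := @beta_evidence_ge R alpha alpha_gt0 (2^-1 + r / 16) (2^-1 + r / 8); try lra.
  exists c => // a b hab; apply: h; first exact: expR_ge0.
  move=> p /andP[p1 p2]; apply: le_trans (expR_le_binary_likelihood _ _ _); last first.
    by apply/andP; split; lra.
  rewrite ler_expR; move: hab; rewrite (gtr0_norm r0) natrD.
  set x := 2 * p - 1; set A := a%:R; set B := b%:R.
  have A0 : 0 <= A by []. have B0 : 0 <= B by [].
  rewrite ler_norml => /andP[h1 h2].
  have qE : q = (r + 1) / 2 by rewrite /r; lra.
  have S : 3 / 4 * r * (A + B) <= A - B by move: h1; rewrite qE; nra.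
  have x1 : r / 8 <= x by rewrite /x; lra.
  have x2 : x <= r / 4 by rewrite /x; lra.
  have -> : (A - B) * x - 2 * (A + B) * x ^+ 2 = x * ((A - B) - 2 * (A + B) * x) by ring.
  apply: (@le_trans _ _ (x * (r / 4 * (A + B)))).
    have -> : (A + B) * r ^+ 2 / 32 = r / 8 * (r / 4 * (A + B)) by field.
    apply: ler_wpM2r; last lra.
    by apply: mulr_ge0; lra.
  rewrite ler_wpM2l//; first lra.
  have : x * (A + B) <= r / 4 * (A + B) by rewrite ler_wpM2r// addr_ge0.
  by lra.
Qed.

(** The constant 1/96 gives [(a - b) ^+ 2 <= N ln N / 24], so that half of the Gaussian penalty
    reduces the linear term to [ln N / 8]. The likelihood is then at most [t = N ^ (1/8)]
    everywhere, and much smaller away from 1/2. *)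
Lemma beta_evidence_le_powR : exists2 C : R, 0 < C & forall a b, (0 < a + b)%N ->
  (a%:R - 2^-1 * (a + b)%:R) ^+ 2 <= 96^-1 * (a + b)%:R * ln ((a + b)%:R : R) ->
  bev a b <= C * ((a + b)%:R : R) `^ (- 8^-1).
Proof.
have [C C0 h] := beta_evidence_le alpha_gt0; exists (C * 49); first by rewrite mulr_gt0.
move=> a b n0 hab.
set N : R := (a + b)%:R.
pose t : R := @powR R N 8^-1.
have N1 : 1 <= N by rewrite ler1n.
have N0 : 0 < N by lra.
have t1 : 1 <= t by rewrite -[leLHS](powRr0 N) ler_powR// invr_ge0.
have t0 : 0 < t by lra.
have tN : N = t ^+ 8.
  by rewrite -powR_mulrn ?(ltW t0)// -powRrM mulVf ?powRr1 ?(ltW N0)// pnatr_eq0.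
have tE : expR (ln N / 8) = t by rewrite mulrC /t /powR gt_eqF.
rewrite powRN -/t.
have D p : 0 < p < 1 -> lik a b p <= t * expR (- (N * (2 * p - 1) ^+ 2 / 12)).
  move=> p01; apply: le_trans (binary_likelihood_le_expR _ _ p01) _.
  rewrite -tE -expRD ler_expR -/N; set x := 2 * p - 1.
  have : (a%:R - b%:R) ^+ 2 <= N * ln N / 24.
    have -> : (a%:R - b%:R) ^+ 2 = 4 * (a%:R - 2^-1 * (a + b)%:R) ^+ 2 :> R.
      by rewrite natrD; field.
    by move: hab; rewrite -/N; lra.
  set S := _ - _ => hS.
  have h1 : S ^+ 2 / N <= ln N / 24 by rewrite ler_pdivrMr//; lra.
  (* AM-GM: [S x <= 3 S^2 / N + N x^2 / 12] *)
  have h2 : 0 <= (6 * S - N * x) ^+ 2 / N by rewrite mulr_ge0 ?sqr_ge0 ?invr_ge0 ?(ltW N0).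
  have h3 : (6 * S - N * x) ^+ 2 / N = 36 * (S ^+ 2 / N) - 12 * (S * x) + N * x ^+ 2.
    have : N != 0 by rewrite gt_eqF.
    by move: (N) (S) (x) => n1 s1 x1 n10; field.
  rewrite h3 in h2; lra.
have r0 : 0 < (t ^- 2) / 2 by rewrite divr_gt0 ?invr_gt0 ?exprn_gt0.
have t21 : t ^- 2 <= 1 by rewrite invf_le1 ?exprn_gt0// exprn_ege1.
have w0 : 0 <= 48 / t by rewrite divr_ge0// ltW.
have ti0 : 0 < t^-1 by rewrite invr_gt0.
(* A half-width of order [t ^- 2] makes the window contribute order [1 / t]. Outside it
   [N x^2 / 12 >= t^4 / 48], and [expR y >= y] already suffices there. *)
have := h a b (t ^- 2 / 2) t (48 / t) r0 _ (ltW t0) w0 _ _.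
have -> : C * (t ^- 2 / 2 * t + 48 / t) = C * (48 + 2^-1) / t by field; rewrite gt_eqF.
move=> H; apply: (@le_trans _ _ (C * (48 + 2^-1) / t)); last first.
  by rewrite ler_wpM2r ?(ltW ti0)// ler_wpM2l ?(ltW C0)//; lra.
apply: H; first lra.
- move=> p /D/le_trans; apply; rewrite ler_piMr ?(ltW t0)// expR_le1 oppr_le0.
  by rewrite divr_ge0// mulr_ge0 ?sqr_ge0// ltW.
- move=> p /D/le_trans p01 hp; apply: p01.
  rewrite -ler_pdivlMl//.
  set x := 2 * p - 1 in hp *.
  have hx : (t ^- 2 / 2) ^+ 2 <= x ^+ 2.
    by rewrite -[leRHS]real_normK ?num_real// lerXn2r ?nnegrE// ltW.
  have y0 : t ^+ 4 / 48 <= N * x ^+ 2 / 12.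
    have -> : t ^+ 4 / 48 = N * (t ^- 2 / 2) ^+ 2 / 12 by rewrite tN; field; rewrite gt_eqF.
    by rewrite ler_pM2r// ler_wpM2l// ltW.
  have y1 : N * x ^+ 2 / 12 <= expR (N * x ^+ 2 / 12).
    by apply: le_trans (expR_ge1Dx _); lra.
  rewrite expRN; apply: (@le_trans _ _ (t ^+ 4 / 48)^-1).
    by rewrite lef_pV2 ?posrE ?expR_gt0 ?divr_gt0 ?exprn_gt0// (le_trans y0).
  have -> : (t ^+ 4 / 48)^-1 = 48 * t ^- 2 * t ^- 2 by field; rewrite gt_eqF.
  have -> : t^-1 * (48 / t) = 48 * t ^- 2 by field; rewrite gt_eqF.
  by rewrite ler_piMr// mulr_ge0// invr_ge0 exprn_ge0// ltW.
Qed.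
End beta_evidence_asymptotics.

(** * The evidence as a function of the cell counts *)

Section integral_beta_measure.
Context {R : realType} (a b : R).
Local Open Scope ereal_scope.
Local Notation leb := (@lebesgue_measure R).
Local Notation dens := (fun p : R => beta_density a b p (1 - p)).
Implicit Types h : R * R -> \bar R.

Import HBNNSimple.

Let measurable_densE : measurable_fun [set: R] (fun p => (dens p)%:E).
Proof. by apply/measurable_EFinP; exact: measurable_beta_density. Qed.

Let densE_ge0 p : 0 <= (dens p)%:E.
Proof. by rewrite lee_fin beta_density_ge0. Qed.

Let integral_beta_indic (A : set (R * R)) : measurable A ->
  \int[beta_measure a b]_t (\1_A t)%:E =
  \int[leb]_(p in `]0%R, 1%R[) ((\1_A (p, 1 - p)%R)%:E * (dens p)%:E).
Proof.
move=> mA; rewrite integral_indic// setIT -[LHS]/(Defs.beta_measure a b A).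
rewrite /Defs.beta_measure integral_mkcondr.
apply: eq_integral => p _; rewrite patchE indicE.
have -> : (p \in [set p : R | A (p, 1 - p)%R]) = ((p, 1 - p)%R \in A).
  by apply/idP/idP; rewrite !inE.
by case: ifP => _; rewrite ?mul1e ?mul0e.
Qed.

Let integral_beta_nnsfun (f : {nnsfun (R * R)%type >-> R}) :
  \int[beta_measure a b]_t (f t)%:E =
  \int[leb]_(p in `]0%R, 1%R[) ((f (p, 1 - p)%R)%:E * (dens p)%:E).
Proof.
under [LHS]eq_integral do rewrite fimfunE -fsumEFin//.
rewrite [LHS]ge0_integral_fsum//; last 2 first.
  - by move=> r; exact/measurable_EFinP/measurableT_comp.
  - by move=> n x _; rewrite EFinM nnfun_muleindic_ge0.
transitivity (\sum_(k \in range f) \int[leb]_(p in `]0%R, 1%R[)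
   ((k * \1_(f @^-1` [set k]) (p, 1 - p)%R)%:E * (dens p)%:E)); last first.
  rewrite -ge0_integral_fsum//.
  - apply: eq_integral => p _; rewrite -ge0_mule_fsuml; last first.
      by move=> r; rewrite EFinM nnfun_muleindic_ge0.
    by rewrite fsumEFin// -fimfunE.
  - move=> r; apply: measurable_funTS; apply: emeasurable_funM => //.
    apply/measurable_EFinP; apply: measurable_funM => //.
    by apply: (measurableT_comp _ measurable_segment).
  - by move=> r p _; rewrite mule_ge0// EFinM nnfun_muleindic_ge0.
apply: eq_fsbigr => r; rewrite inE => -[t _ <-].
under eq_integral do rewrite EFinM.
rewrite ge0_integralZl//; last 2 first.
  - by apply/measurable_EFinP.
  - by rewrite lee_fin.
rewrite integral_beta_indic//.
under [RHS]eq_integral do rewrite EFinM -muleA.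
rewrite ge0_integralZl//.
- apply: measurable_funTS; apply: emeasurable_funM => //; apply/measurable_EFinP.
  by apply: (measurableT_comp _ measurable_segment).
- by move=> p _; rewrite mule_ge0.
- by rewrite lee_fin.
Qed.

(** Substitution along the segment [(p, 1 - p)]: the defining formula is its case of indicators,
    extended to simple functions and then by monotone convergence. *)
Lemma ge0_integral_beta_measure h : measurable_fun setT h -> (forall t, 0 <= h t) ->
  \int[beta_measure a b]_t h t =
  \int[leb]_(p in `]0%R, 1%R[) (h (p, 1 - p)%R * (dens p)%:E).
Proof.
move=> mh h0; pose f_ := nnsfun_approx measurableT mh.
transitivity (limn (fun n => \int[beta_measure a b]_t (f_ n t)%:E)).
  rewrite -monotone_convergence//=.
  - apply: eq_integral => x _; apply/esym/cvg_lim => //=.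
    by apply: cvg_nnsfun_approx.
  - by move=> n; apply/measurable_EFinP.
  - by move=> n x _; rewrite lee_fin.
  - by move=> x _ m n mn; rewrite lee_fin//; exact/lefP/nd_nnsfun_approx.
rewrite [RHS](_ : _ = limn (fun n =>
    \int[leb]_(p in `]0%R, 1%R[) ((f_ n (p, 1 - p)%R)%:E * (dens p)%:E))); last first.
  rewrite -monotone_convergence//=.
  - apply: eq_integral => x _; apply/esym/cvg_lim => //=.
    apply: cvgeZr => //; by apply: cvg_nnsfun_approx.
  - move=> n; apply: measurable_funTS; apply: emeasurable_funM => //.
    by apply/measurable_EFinP; apply: (measurableT_comp _ measurable_segment).
  - by move=> n x _; rewrite mule_ge0// lee_fin.
  - by move=> x _ m n mn; rewrite lee_wpmul2r// lee_fin; have /lefP := nd_nnsfun_approx measurableT mh mn; exact.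
by congr (limn _); apply/funext => n; rewrite integral_beta_nnsfun.
Qed.

End integral_beta_measure.

(** * Integration against the recursive prior *)

Section prior_integral.
Context {R : realType} (alpha : R) (u s : {nonneg R}).
Local Open Scope ereal_scope.
Local Notation prior := (prior alpha u s).
Local Notation beta := (beta_measure alpha alpha).

Lemma ge0_integral_prior_S k (f : branchings (R := R) k.+1 -> \bar R) :
  measurable_fun setT f -> (forall t, 0 <= f t) ->
  \int[prior k.+1]_t f t = u%:num%:E * f (all_half k.+1) +
    s%:num%:E * \int[beta]_t \int[prior k]_a \int[prior k]_b f (t, (a, b)).
Proof.
move=> mf f0.
transitivity (\int[measure_add (mscale u (dirac (all_half (R := R) k.+1)))
  (mscale s (sf_product beta (sf_product (prior k) (prior k))))]_t f t) => //.
rewrite ge0_integral_measure_add// !ge0_integral_mscale// integral_dirac//.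
rewrite diracT mul1e; congr (_ + _ * _).
transitivity (\int[beta \x sf_product (prior k) (prior k)]_t f t) => //.
rewrite fubini_tonelli1//; apply: eq_integral => t _.
rewrite /fubini_F.
transitivity (\int[prior k \x prior k]_ab f (t, ab)) => //.
rewrite (fubini_tonelli1 (fun ab => f (t, ab)))//.
by apply: (measurableT_comp mf); exact: measurable_pair1.
Qed.

Lemma ge0_integral_prior_prod k (h : R * R -> \bar R)
    (g0 g1 : branchings (R := R) k -> \bar R) :
  measurable_fun setT h -> measurable_fun setT g0 -> measurable_fun setT g1 ->
  (forall t, 0 <= h t) -> (forall t, 0 <= g0 t) -> (forall t, 0 <= g1 t) ->
  \int[prior k.+1]_t (h t.1 * (g0 t.2.1 * g1 t.2.2)) =
  u%:num%:E * (h (2^-1, 2^-1)%R * (g0 (all_half k) * g1 (all_half k))) +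
  s%:num%:E * (\int[beta]_t h t * (\int[prior k]_a g0 a * \int[prior k]_b g1 b)).
Proof.
move=> mh mg0 mg1 hp g0p g1p.
rewrite (@ge0_integral_prior_S k (fun t => h t.1 * (g0 t.2.1 * g1 t.2.2))); last 2 first.
- apply: emeasurable_funM; first exact: (measurableT_comp mh measurable_fst).
  apply: emeasurable_funM.
    by apply: (measurableT_comp mg0); apply: measurableT_comp measurable_snd.
  by apply: (measurableT_comp mg1); apply: measurableT_comp measurable_snd.
- by move=> t; rewrite !mule_ge0.
congr (_ + _ * _).
rewrite -ge0_integralZr//; last by rewrite mule_ge0// integral_ge0.
apply: eq_integral => t _ /=.
under eq_integral => a _.
  under eq_integral => b _ do rewrite muleA.
  rewrite ge0_integralZl//; last by rewrite mule_ge0.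
  rewrite -muleA; over.
rewrite ge0_integralZl//.
- rewrite ge0_integralZr//; exact: integral_ge0.
- by apply: emeasurable_funM.
- by move=> a _; rewrite mule_ge0// integral_ge0.
Qed.

End prior_integral.

(** * Measurability and almost sure nonnegativity of the branching entries *)

Section branching_measurable.
Context {R : realType}.

Lemma measurable_branching k (y : bitseq) :
  measurable_fun setT (fun t : branchings (R := R) k => branching t y).
Proof.
elim: k y => [|k IH] [|b y] //=.
case: y => [|b' y]; case: b.
- exact: (measurableT_comp measurable_snd measurable_fst).
- exact: (measurableT_comp measurable_fst measurable_fst).
- apply: (measurableT_comp (IH (b' :: y))).
  exact: (measurableT_comp measurable_snd measurable_snd).
- apply: (measurableT_comp (IH (b' :: y))).
  exact: (measurableT_comp measurable_fst measurable_snd).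
Qed.

(** Entries are unconstrained reals; on this set, of full prior measure, all likelihoods are
    nonnegative. *)
Fixpoint branchings_ge0 (k : nat) : set (branchings (R := R) k) :=
  match k return set (branchings (R := R) k) with
  | 0 => setT
  | k'.+1 => [set t : R * R | 0 <= t.1 /\ 0 <= t.2] `*`
             (@branchings_ge0 k' `*` @branchings_ge0 k')
  end.
Arguments branchings_ge0 : clear implicits.

Let quadrant : set (R * R) := [set t | 0 <= t.1 /\ 0 <= t.2].

Let measurable_quadrant : measurable quadrant.
Proof.
have -> : quadrant = (fst @^-1` `[0, +oo[ : set (R * R)) `&` snd @^-1` `[0, +oo[.
  by apply/seteqP; split => t /=; rewrite !in_itv/= !andbT.
by apply: measurableI; rewrite -[X in measurable X]setTI;
  [exact: measurable_fst|exact: measurable_snd].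
Qed.

Lemma measurable_branchings_ge0 k : measurable (branchings_ge0 k).
Proof.
elim: k => [|k IH] /=; first exact: measurableT.
by apply: measurableX => //; exact: measurableX.
Qed.

Lemma branching_ge0 k (t : branchings k) y : branchings_ge0 k t -> 0 <= branching t y.
Proof.
elim: k t y => [|k IH] t [|b y] //=.
by move=> [[? ?] [? ?]]; case: y => [|b' y]; case: b => //; exact: IH.
Qed.

Variables (alpha : R) (u s : {nonneg R}).

Lemma all_half_ge0 k : branchings_ge0 k (all_half k).
Proof. by elim: k => //= k IH; split => //=; split; rewrite /= invr_ge0. Qed.

Lemma prior_setX k (A : set (R * R)) (B : set (branchings k * branchings k)) :
  measurable A -> measurable B -> prior alpha u s k.+1 (A `*` B) =
  (u%:num%:E * \d_(all_half k.+1 : branchings k.+1) (A `*` B) + s%:num%:E *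
    (beta_measure alpha alpha A * (prior alpha u s k \x prior alpha u s k) B))%E.
Proof.
move=> mA mB.
transitivity (measure_add (mscale u (dirac (all_half (R := R) k.+1)))
  (mscale s (sf_product (beta_measure alpha alpha)
    (sf_product (prior alpha u s k) (prior alpha u s k)))) (A `*` B)) => //.
rewrite measure_addE /mscale/=; congr (_ + _ * _)%E.
transitivity ((beta_measure alpha alpha \x
  sf_product (prior alpha u s k) (prior alpha u s k)) (A `*` B))%E => //.
by rewrite product_measure1E.
Qed.

(** The complement is covered by three rectangles, according to where a negative entry sits. The
    Dirac atom avoids each of them, and one factor of the product measure vanishes on it. *)
Lemma prior_branchings_ge0 k : (prior alpha u s k).-negligible (~` branchings_ge0 k).
Proof.
elim: k => [|k IH]; first by rewrite /= setCT; exact: negligible_set0.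
apply: (@negligibleS _ _ _ _ (((~` quadrant) `*` setT) `|`
   (setT `*` ((~` branchings_ge0 k) `*` setT) `|`
    setT `*` (setT `*` (~` branchings_ge0 k))))).
  move=> [t [a b]] /= H.
  have [tq|tq] := pselect (quadrant t); last by left.
  right; have [ta|ta] := pselect (branchings_ge0 k a); last by left.
  by right; do 2 split => //; move=> tb; apply: H.
have mN := measurable_branchings_ge0 k.
have N0 : prior alpha u s k (~` branchings_ge0 k) = 0%E.
  by apply: measure_negligible => //; exact: measurableC.
have beta0 : beta_measure alpha alpha (~` quadrant) = 0%E.
  rewrite /= /Defs.beta_measure (_ : _ `&` _ = set0) ?integral_set0//.
  apply/seteqP; split => // p [] /=; rewrite in_itv/= => /andP[p0 p1]; apply; split => /=; lra.
have mC := measurableC mN.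
have mQ := measurableC measurable_quadrant.
have half0 : all_half (R := R) k \in ~` branchings_ge0 k = false.
  by apply/negbTE; rewrite notin_setE => /=; apply; exact: all_half_ge0.
have mCX : measurable ((~` branchings_ge0 k) `*` [set: branchings (R := R) k]) by exact: measurableX.
have mXC : measurable ([set: branchings (R := R) k] `*` (~` branchings_ge0 k)) by exact: measurableX.
have P1 : (prior alpha u s k \x prior alpha u s k)%E ((~` branchings_ge0 k) `*` setT) = 0%E.
  rewrite product_measure1E//; apply/eqP; rewrite mule_eq0; apply/orP; left.
  by apply/eqP; exact: N0.
have P2 : (prior alpha u s k \x prior alpha u s k)%E (setT `*` (~` branchings_ge0 k)) = 0%E.
  rewrite product_measure1E//; apply/eqP; rewrite mule_eq0; apply/orP; right.
  by apply/eqP; exact: N0.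
apply: negligibleU; [|apply: negligibleU]; apply/negligibleP.
- exact: measurableX.
- rewrite [LHS](prior_setX (A := ~` quadrant))// beta0 mul0e mule0 adde0 diracE.
  rewrite (_ : _ \in _ = false) ?mule0//.
  apply/negbTE; rewrite notin_setE => -[/= H _]; apply: H.
  by split; rewrite /= invr_ge0.
- exact: measurableX.
- rewrite [LHS](prior_setX (A := setT))// P1 !mule0 adde0 diracE.
  rewrite (_ : _ \in _ = false) ?mule0//.
  by apply/negbTE; rewrite notin_setE => -[_ /= [H _]]; apply: H; exact: all_half_ge0.
- exact: measurableX.
- rewrite [LHS](prior_setX (A := setT))// P2 !mule0 adde0 diracE.
  rewrite (_ : _ \in _ = false) ?mule0//.
  by apply/negbTE; rewrite notin_setE => -[_ /= [_ H]]; apply: H; exact: all_half_ge0.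
Qed.
End branching_measurable.
Arguments branchings_ge0 {R} k.

(** * Addresses of points and factorisation of the likelihood *)

Section tree_addresses.
Context {d : measure_display} {T : measurableType d} {R : realType}.
Variables (vol : probability T R) (m : nat) (cell : bitseq -> set T).
Hypothesis Hcell : tree_partition vol m cell.

Lemma cell_rcons_sub z b : (size z < m)%N -> cell (rcons z b) `<=` cell z.
Proof.
by move=> zm; rewrite (cell_split Hcell zm); case: b; [exact: subsetUr|exact: subsetUl].
Qed.

Lemma cell_cat_sub z y : (size (z ++ y) <= m)%N -> cell (z ++ y) `<=` cell z.
Proof.
elim/last_ind: y => [|y b IH]; first by rewrite cats0 => _.
rewrite -rcons_cat size_rcons => h; apply: subset_trans (IH (ltnW h)).
exact: cell_rcons_sub.
Qed.

Lemma cell_inj w1 w2 x : size w1 = size w2 -> (size w1 <= m)%N ->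
  cell w1 x -> cell w2 x -> w1 = w2.
Proof.
elim/last_ind: w1 w2 => [|w1 b1 IH] w2; first by case: w2.
elim/last_ind: w2 => [|w2 b2 _]; first by rewrite size_rcons.
rewrite !size_rcons => -[sz] h x1 x2.
have E : w1 = w2.
  apply: IH => //; first exact: ltnW.
    exact: (cell_rcons_sub h x1).
  by apply: (cell_rcons_sub _ x2); rewrite -sz.
subst w2; congr rcons; have := cell_disjoint Hcell h.
case: b1 x1; case: b2 x2 => // x2 x1 H.
  by have : set0 x by rewrite -H; split.
by have : set0 x by rewrite -H; split.
Qed.

Lemma cell_exists i x : (i <= m)%N -> exists w, size w = i /\ cell w x.
Proof.
elim: i => [|i IH] im; first by exists [::]; rewrite (cell_nil Hcell).
have [w [sw xw]] := IH (ltnW im); move: xw; rewrite (cell_split Hcell); last by rewrite sw.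
by move=> [xw|xw]; [exists (rcons w false)|exists (rcons w true)]; rewrite size_rcons sw.
Qed.

Lemma address_eq w x : (size w <= m)%N -> cell w x -> address cell (size w) x = w.
Proof.
move=> wm xw; rewrite /address.
have [s1 x1] := @xgetPex _ [::] [set v : bitseq | size v = size w /\ cell v x]
  (ex_intro _ w (conj erefl xw)).
by apply: (@cell_inj _ _ x) => //; rewrite s1.
Qed.

Lemma address_cat z x i : (size z + i <= m)%N -> cell z x ->
  exists2 y, size y = i & address cell (size z + i) x = z ++ y.
Proof.
move=> him xz; have [w [sw xw]] := cell_exists x him.
have E : take (size z) w = z.
  apply: (@cell_inj _ _ x) => //; first by rewrite size_takel// sw leq_addr.
    by rewrite size_takel ?sw ?leq_addr// (leq_trans _ him)// leq_addr.
  by apply: (@cell_cat_sub _ (drop (size z) w)); rewrite cat_take_drop// sw.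
exists (drop (size z) w); first by rewrite size_drop sw addKn.
by rewrite -sw address_eq ?sw// -[in LHS](cat_take_drop (size z) w) E.
Qed.

Lemma sublist_sublist z y (D : seq T) : (size (z ++ y) <= m)%N ->
  sublist cell (z ++ y) (sublist cell z D) = sublist cell (z ++ y) D.
Proof.
move=> h; rewrite /sublist -filter_predI; apply: eq_filter => x /=.
apply/andb_idr; rewrite !inE; exact: cell_cat_sub.
Qed.

Lemma mem_cell_rcons z b x : (size z < m)%N -> cell z x ->
  (x \in cell (rcons z (~~ b))) = ~~ (x \in cell (rcons z b)).
Proof.
move=> zm; rewrite (cell_split Hcell zm) => xz.
have := cell_disjoint Hcell zm.
move: xz; set A := cell (rcons z false); set B := cell (rcons z true) => xz AB.
have H : (x \in A) = ~~ (x \in B).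
  apply/idP/idP; rewrite ?inE.
    by move=> xA; apply/negP; rewrite inE => xB; have : set0 x by rewrite -AB.
  by move=> /negP; rewrite inE; case: xz.
by case: b => //=; rewrite H negbK.
Qed.

Lemma notin_cell_rcons z b x : (size z < m)%N -> x \notin cell z ->
  (x \in cell (rcons z b)) = false.
Proof.
move=> zm xz; apply/negbTE; apply: contra xz => /set_mem xb.
by apply: mem_set; exact: (cell_rcons_sub zm xb).
Qed.

(** [likelihood1] with the depth [k] freed from [m - size z], so that induction on [k] can descend
    into subtrees. *)
Definition path_likelihood (z : bitseq) (k : nat) (theta : branchings (R := R) k) (x : T) : R :=
  \prod_((size z).+1 <= i < (size z + k).+1)
    (2 * branching theta (drop (size z) (address cell i x))).

Lemma path_likelihood_S z b k (t : branchings k.+1) x :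
  (size z + k.+1 <= m)%N -> cell (rcons z b) x ->
  path_likelihood z t x = 2 * (if b then t.1.2 else t.1.1) *
    path_likelihood (rcons z b) (if b then t.2.2 else t.2.1) x.
Proof.
move=> zk xb; rewrite /path_likelihood big_ltn; last by rewrite ltnS addnS ltnS leq_addr.
have sb : size (rcons z b) = (size z).+1 by rewrite size_rcons.
have zm : (size (rcons z b) <= m)%N by rewrite sb (leq_trans _ zk)// addnS ltnS leq_addr.
congr (_ * _).
  by rewrite -sb address_eq// -cats1 drop_size_cat//=.
rewrite sb addSn addnS; apply: eq_big_nat => i /andP[i1 i2].
(* The offset [j.+1] makes the remaining string [y] nonempty, so [branching] descends below [b]
   instead of returning the entry at [b]. *)
have [j jE] : exists j, i = ((size z).+1 + j.+1)%N.
  by exists (i - (size z).+2)%N; rewrite addnS -addSn subnKC.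
have [|y sy E] := @address_cat (rcons z b) x j.+1 _ xb.
  by rewrite sb -jE; move: i2 zk => *; lia.
rewrite jE -sb E {1}cat_rcons (drop_size_cat _ (erefl (size z))) (drop_size_cat _ (erefl _)).
by case: y sy {E} => // c y _; case: b {xb sb zm}.
Qed.

Lemma path_likelihood_half z k x : (size z + k <= m)%N -> cell z x ->
  path_likelihood z (all_half k) x = 1.
Proof.
move=> zk xz; rewrite /path_likelihood big_nat big1// => i /andP[i1 i2].
have [|y sy E] := @address_cat z x (i - size z) _ xz.
  by rewrite subnKC ?(ltnW i1)// (leq_trans _ zk).
rewrite (subnKC (ltnW i1)) in E.
rewrite E drop_size_cat//.
have : (0 < size y <= k)%N.
  by rewrite sy subn_gt0 i1/= leq_subLR.
have H : forall k y, (0 < size y <= k)%N -> branching (all_half (R := R) k) y = 2^-1.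
  elim=> [|k' IH] [|b [|c y']]//= h; first by case: b.
  by case: b; apply: IH.
by move=> /H ->; rewrite divff.
Qed.

Lemma path_likelihood_ge0 z k (t : branchings k) x : branchings_ge0 k t ->
  0 <= path_likelihood z t x.
Proof.
by move=> t0; rewrite prodr_ge0// => i _; rewrite mulr_ge0// branching_ge0.
Qed.

Definition sample_likelihood (z : bitseq) (k : nat) (theta : branchings (R := R) k)
  (E : seq T) : R := \prod_(x <- E) path_likelihood z theta x.

Lemma measurable_sample_likelihood z k (E : seq T) :
  measurable_fun setT (fun t : branchings (R := R) k => sample_likelihood z t E).
Proof.
apply: measurable_prod => x _; apply: measurable_prod => i _.
by apply: measurable_funM => //; exact: measurable_branching.
Qed.

(** The node and its two subtrees enter as separate factors, matching the product structure of the
    prior. *)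
Lemma sample_likelihood_S z k (t : branchings k.+1) (E : seq T) :
  (size z + k.+1 <= m)%N -> {in E, forall x, cell z x} ->
  sample_likelihood z t E =
  (2 * t.1.1) ^+ size (sublist cell (rcons z false) E) *
  (2 * t.1.2) ^+ size (sublist cell (rcons z true) E) *
  (sample_likelihood (rcons z false) t.2.1 (sublist cell (rcons z false) E) *
   sample_likelihood (rcons z true) t.2.2 (sublist cell (rcons z true) E)).
Proof.
move=> zk; elim: E => [|x E IH] xE.
  by rewrite /sample_likelihood/= !big_nil !mulr1.
have zm : (size z < m)%N by rewrite (leq_trans _ zk)// addnS ltnS leq_addr.
have xz : cell z x by apply: xE; rewrite mem_head.
have := mem_cell_rcons false zm xz; rewrite /=.
rewrite /sample_likelihood big_cons -/(sample_likelihood z t E) IH; last first.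
  by move=> y yE; apply: xE; rewrite in_cons yE orbT.
case: ifPn => [x0|x0] ->/=.
- rewrite (@path_likelihood_S z false _ t x)//; last by rewrite inE in x0.
  by rewrite /sample_likelihood big_cons exprS; ring.
- rewrite (@path_likelihood_S z true _ t x)//; last first.
    have := mem_cell_rcons false zm xz; rewrite (negbTE x0)/= => /idP; by rewrite inE.
  by rewrite /sample_likelihood big_cons exprS; ring.
Qed.
End tree_addresses.

(** The counts form an arbitrary function [c], so adding an observation is a change of [c]; only
    strict descendants of [z] are consulted. *)
Fixpoint count_evidence {R : realType} (alpha u s : R) (k : nat) (z : bitseq)
    (c : bitseq -> nat) : R :=
  if k is k'.+1 then
    u + s * (beta_evidence alpha (c (rcons z false)) (c (rcons z true)) *
      (count_evidence alpha u s k' (rcons z false) c *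
       count_evidence alpha u s k' (rcons z true) c))
  else 1.

Lemma eq_count_evidence {R : realType} (alpha u s : R) k z (c c' : bitseq -> nat) :
  (forall y, (0 < size y <= k)%N -> c (z ++ y) = c' (z ++ y)) ->
  count_evidence alpha u s k z c = count_evidence alpha u s k z c'.
Proof.
elim: k z => //= k IH z H.
have rc b y : rcons z b ++ y = z ++ b :: y by rewrite cat_rcons.
rewrite -!cats1 !H// !cats1.
by congr (_ + _ * (_ * (_ * _))); apply: IH => y /andP[_ ky]; rewrite !rc H.
Qed.

(** * From the evidence integral to the counts *)

Section evidence_recursion.
Context {d : measure_display} {T : measurableType d} {R : realType}.
Variables (vol : probability T R) (m : nat) (cell : bitseq -> set T).
Hypothesis Hcell : tree_partition vol m cell.
Variables (alpha : R) (u s : {nonneg R}).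
Hypothesis alpha_gt0 : 0 < alpha.
Local Notation lik := (@binary_likelihood R).
Local Notation cev := (count_evidence alpha u%:num s%:num).
Local Notation pr := (prior alpha u s).

Definition counts (D : seq T) (w : bitseq) : nat := size (sublist cell w D).

Lemma integral_binary_likelihood a b :
  (\int[beta_measure alpha alpha]_t `|(2 * t.1) ^+ a * (2 * t.2) ^+ b|%:E =
   (beta_evidence alpha a b)%:E)%E.
Proof.
rewrite ge0_integral_beta_measure//.
- rewrite EFin_beta_evidence//; apply: eq_integral => p; rewrite inE/= in_itv/= => p01.
  rewrite -EFinM; congr ((_ * _)%:E); rewrite ger0_norm//.
  exact: binary_likelihood_ge0.
- apply/measurable_EFinP; apply: measurableT_comp => //.
  by apply: measurable_funM; apply: measurable_funX; apply: measurable_funM.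
Qed.

(* The entries are unconstrained reals, so the likelihood is nonnegative only almost
   everywhere; the absolute value makes Tonelli applicable. *)
Lemma integral_sample_likelihood z k (E : seq T) :
  (size z + k <= m)%N -> {in E, forall x, cell z x} ->
  (\int[pr k]_t `|sample_likelihood cell z t E|%:E = (cev k z (counts E))%:E)%E.
Proof.
elim: k z E => [|k IH] z E zk xE.
  under eq_integral => t _.
    have -> : sample_likelihood cell z t E = 1.
      by rewrite /sample_likelihood big1// => x _; rewrite /path_likelihood addn0 big_geq.
    over.
  rewrite integral_cst//= normr1 mul1e; exact: diracT.
pose n b := size (sublist cell (rcons z b) E).
have mL w k' E' : measurable_fun setT (fun t : branchings k' => `|sample_likelihood cell w t E'|%:E).
  by apply/measurable_EFinP; apply: measurableT_comp => //; exact: measurable_sample_likelihood.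
have sub b : {in sublist cell (rcons z b) E, forall x, cell (rcons z b) x}.
  by move=> x; rewrite mem_filter => /andP[/set_mem].
have szb b : (size (rcons z b) + k <= m)%N by rewrite size_rcons addSn -addnS.
pose h (t : R * R) := `|(2 * t.1) ^+ n false * (2 * t.2) ^+ n true|%:E.
pose g b (t : branchings (R := R) k) :=
  `|sample_likelihood cell (rcons z b) t (sublist cell (rcons z b) E)|%:E.
have mh : measurable_fun setT h.
  apply/measurable_EFinP; apply: measurableT_comp => //.
  by apply: measurable_funM; apply: measurable_funX; apply: measurable_funM.
transitivity (\int[pr k.+1]_t (h t.1 * (g false t.2.1 * g true t.2.2)))%E.
  apply: eq_integral => t _; rewrite (sample_likelihood_S Hcell)// /h /g normrM EFinM.
  by rewrite (normrM (sample_likelihood _ _ _ _)) EFinM.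
rewrite (@ge0_integral_prior_prod _ _ _ _ _ h (g false) (g true))//; try exact: mL;
  try by move=> t; rewrite lee_fin.
rewrite /h /g.
rewrite integral_binary_likelihood !IH//.
(* At the Dirac atom every factor is [2 * 2^-1], so the first mixture component contributes exactly
   [u]. *)
have half1 b : `|sample_likelihood cell (rcons z b) (all_half k) (sublist cell (rcons z b) E)| = 1 :> R.
  rewrite /sample_likelihood big_seq big1 ?normr1// => x xE'.
  by rewrite (path_likelihood_half Hcell)//; exact: sub.
rewrite !half1 divff// !expr1n !mulr1 normr1 !mule1 -!EFinM -EFinD /=.
congr (_ + _ * (_ * (_ * _)))%:E; apply: eq_count_evidence => y /andP[_ yk];
  rewrite /counts (sublist_sublist Hcell)// size_cat size_rcons; move: zk yk => *; lia.
Qed.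

Lemma evidence_sublist z (D : seq T) : (size z <= m)%N ->
  evidence m cell alpha u s z (sublist cell z D) = cev (m - size z) z (counts D).
Proof.
move=> zm.
transitivity (cev (m - size z) z (counts (sublist cell z D))); last first.
  apply: eq_count_evidence => y /andP[_ yk]; rewrite /counts (sublist_sublist Hcell)//.
  by rewrite size_cat; move: yk zm => *; lia.
apply: EFin_inj; rewrite -integral_sample_likelihood ?subnKC//; last first.
  by move=> x; rewrite mem_filter => /andP[/set_mem].
rewrite /evidence /Rintegral.
have -> : (\int[pr (m - size z)]_t
    (likelihood m cell z (branching_at t) (sublist cell z D))%:E =
    \int[pr (m - size z)]_t `|sample_likelihood cell z t (sublist cell z D)|%:E)%E.
  have LE (t : branchings (R := R) (m - size z)) : likelihood m cell z (branching_at t) (sublist cell z D) =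
      sample_likelihood cell z t (sublist cell z D).
    rewrite /sample_likelihood /likelihood; apply: eq_bigr => x _.
    by rewrite /path_likelihood /likelihood1 subnKC.
  (* The absolute value changes the integrand only where some entry is negative, a prior-negligible
     set. *)
  apply: ae_eq_integral => //.
  - apply/measurable_EFinP.
    apply: eq_measurable_fun (measurable_sample_likelihood cell z _) => t _.
    by rewrite LE.
  - apply/measurable_EFinP; apply: measurableT_comp => //.
    exact: measurable_sample_likelihood.
  - apply: negligibleS (prior_branchings_ge0 alpha u s (m - size z)).
    move=> t /= H t0; apply: H => _; rewrite LE ger0_norm//.
    by apply: prodr_ge0 => x _; exact: path_likelihood_ge0.
rewrite fineK// integral_sample_likelihood ?subnKC//.
by move=> x; rewrite mem_filter => /andP[/set_mem].
Qed.
End evidence_recursion.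

(** * Fluctuations of the counts *)

Section ville.
Context {d d' : measure_display} {Om : measurableType d} {T : measurableType d'}
  {R : realType}.
Variables (Pr : probability Om R) (P : probability T R) (X : nat -> {mfun Om >-> T}).
Hypothesis HX : iid Pr P X.

Lemma iid_cylinder (n : nat) (B : nat -> set T) : (forall i, measurable (B i)) ->
  Pr (\bigcap_(i in `I_n) (X i @^-1` B i)) = (\prod_(i < n) fine (P (B i)))%:E.
Proof.
move=> mB; rewrite (iid_indep HX)//; congr (_%:E); apply: eq_bigr => i _.
by rewrite -(iid_law HX i (mB i)).
Qed.

Variables (N : nat) (A : nat -> set T) (w : nat -> R) (g : T -> R).
Hypothesis mA : forall i, measurable (A i).
Hypothesis w_ge0 : forall i, 0 <= w i.
Hypothesis Ag : forall x, exists i, [/\ (i < N)%N, A i x & g x = w i].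
Hypothesis mg : measurable_fun setT g.
Hypothesis mean_le1 : \sum_(i < N) w i * fine (P (A i)) <= 1.

(** [y] is the capital held before observation [k], and [n] the remaining horizon; leaving both free
    makes the induction on [n] possible. *)
Let crosses (lam y : R) (k n : nat) : set Om :=
  [set om | exists2 j, (j <= n)%N & lam <= y * \prod_(k <= i < k + j) g (X i om)].

Let measurable_crosses lam y k n : measurable (crosses lam y k n).
Proof.
have -> : crosses lam y k n = \bigcup_(j in `I_n.+1)
    ((fun om => y * \prod_(k <= i < k + j) g (X i om)) @^-1` `[lam, +oo[).
  apply/seteqP; split => om /=.
    by move=> [j jn h]; exists j; rewrite /= ?ltnS// in_itv/= andbT.
  by move=> [j]; rewrite /= ltnS in_itv/= andbT => jn h; exists j.
apply: bigcup_measurable => j _; rewrite -[X in measurable X]setTI.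
have mf : measurable_fun setT (fun om => y * \prod_(k <= i < k + j) g (X i om)).
  apply: measurable_funM => //; apply: measurable_prod => i _.
  by apply: (measurableT_comp mg); exact: measurable_funP.
by apply: mf.
Qed.

Let cylinder (k : nat) (B : nat -> set T) := \bigcap_(i in `I_k) (X i @^-1` B i).

Let measurable_cylinder k B : (forall i, measurable (B i)) -> measurable (cylinder k B).
Proof.
move=> mB; apply: bigcap_measurableType => // i _.
by rewrite -[X in measurable X]setTI; exact: measurable_funP.
Qed.

(* Optional stopping by induction on the horizon [n]: as the weights take finitely many
   values, conditioning on the next observation is a finite sum over cylinders. *)
Let measure_crosses_le (lam y : R) k n (B : nat -> set T) :
  0 < lam -> 0 <= y -> (forall i, measurable (B i)) ->
  (Pr (cylinder k B `&` crosses lam y k n) <=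
   (y / lam * \prod_(i < k) fine (P (B i)))%:E)%E.
Proof.
move=> l0; elim: n k y B => [|n IH] k y B y0 mB;
  have pB : 0 <= \prod_(i < k) fine (P (B i)) by
    apply: prodr_ge0 => i _; exact: fine_ge0.
all: have [ly|yl] := leP lam y.
- apply: (@le_trans _ _ (Pr (cylinder k B))).
    by apply: le_measure; rewrite ?inE//; [apply: measurableI => //|]; exact: measurable_cylinder.
  by rewrite iid_cylinder// lee_fin ler_peMl// ler_pdivlMr// mul1r.
- rewrite (_ : _ `&` _ = set0); first by rewrite measure0 lee_fin mulr_ge0// divr_ge0// ltW.
  apply/seteqP; split => // om [_ [j]]; rewrite leqn0 => /eqP ->.
  by rewrite addn0 big_geq// mulr1 leNgt yl.
- apply: (@le_trans _ _ (Pr (cylinder k B))).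
    by apply: le_measure; rewrite ?inE//; [apply: measurableI => //|]; exact: measurable_cylinder.
  by rewrite iid_cylinder// lee_fin ler_peMl// ler_pdivlMr// mul1r.
pose B' i l := if l == k then A i else B l.
have mB' i l : measurable (B' i l) by rewrite /B'; case: ifP.
pose F i := cylinder k.+1 (B' i) `&` crosses lam (y * w i) k.+1 n.
have mF i : measurable (F i).
  by apply: measurableI => //; exact: measurable_cylinder.
(* If [lam] is not yet reached, the next observation falls in some [A i] and multiplies the capital
   by [w i]. A union bound over [i] and [mean_le1] then close the induction. *)
apply: (@le_trans _ _ (Pr (\big[setU/set0]_(i < N) F i))).
  apply: le_measure; rewrite ?inE.
  - by apply: measurableI => //; exact: measurable_cylinder.
  - exact: bigsetU_measurable.
  move=> om [Bom [[|j] jn]]; first by rewrite addn0 big_geq// mulr1 leNgt yl.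
  rewrite big_ltn ?addnS ?ltnS ?leq_addr// => h.
  have [i [iN Ai gi]] := Ag (X k om).
  rewrite -bigcup_mkord; exists i => //; split.
    move=> l /=; rewrite ltnS leq_eqVlt => /predU1P[->|lk]; rewrite /B' ?eqxx//.
    by rewrite ltn_eqF//; exact: Bom.
  by exists j => //; rewrite -mulrA -gi addSn.
apply: le_trans (Boole_inequality _ _) _; first by move=> i _; exact: mF.
apply: (@le_trans _ _ (\sum_(i < N) ((y * w i / lam) *
    (\prod_(l < k) fine (P (B l)) * fine (P (A i))))%:E)%E).
  apply: lee_sum => i _; apply: le_trans (IH _ _ _ _ (mB' i)) _.
    by rewrite mulr_ge0.
  rewrite big_ord_recr/= {2}/B' eqxx lee_fin.
  rewrite (eq_bigr (fun l : 'I_k => fine (P (B l))))// => l _.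
  by rewrite /B' ltn_eqF.
rewrite sumEFin lee_fin.
rewrite (eq_bigr (fun i : 'I_N => y / lam * \prod_(l < k) fine (P (B l)) *
   (w i * fine (P (A i))))); last by move=> i _; ring.
by rewrite -big_distrr/= ler_piMr// mulr_ge0// divr_ge0// ltW.
Qed.

Let exists_prod_geE (lam : R) :
  [set om | exists n, lam <= \prod_(x <- sample X n om) g x] = \bigcup_n crosses lam 1 0 n.
Proof.
apply/seteqP; split => om /=.
  move=> [n h]; exists n => //; exists n => //.
  by move: h; rewrite /sample big_map mul1r add0n /index_iota subn0.
move=> [_ _ [n _ h]]; exists n.
by move: h; rewrite /sample big_map mul1r add0n /index_iota subn0.
Qed.

Lemma measurable_exists_prod_ge (lam : R) :
  measurable [set om | exists n, lam <= \prod_(x <- sample X n om) g x].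
Proof.
by rewrite exists_prod_geE; exact: bigcup_measurable.
Qed.

(* Ville's inequality *)
Lemma measure_exists_prod_ge (lam : R) : 0 < lam ->
  (Pr [set om | exists n, (lam <= \prod_(x <- sample X n om) g x)%R] <= (lam^-1)%:E)%E.
Proof.
move=> l0.
rewrite exists_prod_geE.
have nd : nondecreasing_seq (crosses lam 1 0).
  move=> n1 n2 n12; apply/subsetPset => om [j jn h]; exists j => //.
  exact: leq_trans n12.
have C := @nondecreasing_cvg_mu _ _ _ Pr _ (measurable_crosses lam 1 0)
  (bigcup_measurable (fun k _ => measurable_crosses lam 1 0 k)) nd.
rewrite -(cvg_lim _ C)//; apply: lime_le; first exact: cvgP C.
apply: nearW => n /=.
have := @measure_crosses_le lam 1 0 n (fun=> setT) l0 ler01 (fun=> measurableT).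
have -> : cylinder 0 (fun=> setT) `&` crosses lam 1 0 n = crosses lam 1 0 n.
  by apply/seteqP; split => om //=; case.
by rewrite big_ord0 mulr1 div1r.
Qed.

End ville.

Section borel_cantelli.
Context {d : measure_display} {Om : measurableType d} {R : realType}.
Variable Pr : probability Om R.

(** Borel-Cantelli, with a geometric series of ratio [expR (- kap)]. *)
Lemma ae_eventually_not (F : nat -> set Om) (kap : R) : 0 < kap ->
  (forall k, measurable (F k)) ->
  (forall k, (Pr (F k) <= (expR (- (kap * k%:R)))%:E)%E) ->
  {ae Pr, forall om, \forall k \near \oo, ~ F k om}.
Proof.
move=> k0 mF hF.
have r1 : `|expR (- kap)| < 1 by rewrite ger0_norm ?expR_ge0// expR_lt1 oppr_lt0.
have L0 : Pr (lim_sup_set F) = 0%E.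
  apply: lim_sup_set_cvg0 => //.
  apply: (@le_lt_trans _ _ (\sum_(0 <= k <oo) (expR (- kap) ^+ k)%:E)%E).
    apply: lee_nneseries => // k _.
    by apply: le_trans (hF k) _; rewrite -expRM_natl lee_fin mulrN mulrC.
  apply: (@le_lt_trans _ _ ((1 - expR (- kap))^-1)%:E); last exact: ltry.
  apply: lime_le; first by apply: is_cvg_nneseries => k _ _; rewrite lee_fin exprn_ge0// expR_ge0.
  apply: nearW => n; rewrite sumEFin lee_fin.
  have := @subrX1 R (expR (- kap)) n.
  set r := expR (- kap) in r1 *; rewrite big_mkord => E.
  have r11 : r < 1 by move: r1; rewrite ger0_norm ?expR_ge0.
  rewrite -[leRHS]mul1r ler_pdivlMr ?subr_gt0// mulrC -opprB mulNr -E opprB.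
  by rewrite lerBlDr lerDl exprn_ge0 ?expR_ge0.
exists (lim_sup_set F); split => //.
  apply: bigcap_measurableType => n _; exact: bigcup_measurable.
move=> om /= H n _; apply: contrapT => H'; apply: H.
exists n => // k /= nk Fk; apply: H'; exists k => //.
Qed.
End borel_cantelli.

(** * Fair bets on the branching at a node *)

Section fluctuations.
Context {d d' : measure_display} {Om : measurableType d} {T : measurableType d'}
  {R : realType}.
Variables (vol : probability T R) (m : nat) (cell : bitseq -> set T).
Hypothesis Hcell : tree_partition vol m cell.
Variables (P : probability T R) (q : bitseq -> R).
Hypothesis Hmodel : tree_model vol m cell P q.
Variables (Pr : probability Om R) (X : nat -> {mfun Om >-> T}).
Hypothesis HX : iid Pr P X.

Lemma counts_split z (D : seq T) : (size z < m)%N ->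
  counts cell D z = (counts cell D (rcons z false) + counts cell D (rcons z true))%N.
Proof.
move=> zm; rewrite /counts /sublist; elim: D => //= x D IH.
have [xz|xz] := boolP (x \in cell z).
  have := mem_cell_rcons Hcell false zm (set_mem xz); rewrite /=.
  by case: ifPn => [x0|x0] ->/=; rewrite IH ?addSn ?addnS.
by rewrite !(notin_cell_rcons Hcell _ zm xz).
Qed.

Lemma branch_le1 z b : (size z < m)%N -> 0 <= q (rcons z b) <= 1.
Proof.
move=> zm; have := branch_sum Hmodel zm.
have := branch_ge0 Hmodel false zm; have := branch_ge0 Hmodel true zm.
by case: b => *; apply/andP; split; lra.
Qed.

(** A fair bet of stake [t] on the left child: its mean is 1 for every [t], because the left child
    has conditional probability [q (rcons z false)]. It is 1 off [cell z], so products ignore the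
    other points. *)
Definition node_weight (z : bitseq) (t : R) (x : T) : R :=
  1 + t * (1 - q (rcons z false)) * \1_(cell (rcons z false)) x
  - t * q (rcons z false) * \1_(cell (rcons z true)) x.

Section martingale.
Variables (z : bitseq) (t : R).
Hypothesis zm : (size z < m)%N.
Hypothesis t_le : `|t| <= 2^-1.
Let q0 := q (rcons z false).
Local Notation g := (node_weight z t).

Lemma prod_weightE (D : seq T) : \prod_(x <- D) g x =
  (1 + t * (1 - q0)) ^+ counts cell D (rcons z false) *
  (1 - t * q0) ^+ counts cell D (rcons z true).
Proof.
rewrite /counts /sublist; elim: D => [|x D IH]; first by rewrite big_nil mulr1.
rewrite big_cons IH /node_weight -/q0 !indicE /=.
have [xz|xz] := boolP (x \in cell z).
  have := mem_cell_rcons Hcell false zm (set_mem xz); rewrite /=.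
  case: ifPn => [x0|x0] -> /=; rewrite ?exprS ?(negbTE x0); ring.
by rewrite !(notin_cell_rcons Hcell _ zm xz)/=; ring.
Qed.

Let measurable_child b : measurable (cell (rcons z b)).
Proof. by apply: (cell_measurable Hcell); rewrite size_rcons. Qed.

Let measurable_g : measurable_fun setT g.
Proof.
by apply: measurable_funB; [apply: measurable_funD => //|]; apply: measurable_funM.
Qed.

Lemma measurable_weight_crosses (lam : R) :
  measurable [set om | exists n, lam <= \prod_(x <- sample X n om) g x].
Proof. exact: measurable_exists_prod_ge. Qed.

Lemma measure_weight_crosses (lam : R) : 0 < lam ->
  (Pr [set om | exists n, (lam <= \prod_(x <- sample X n om) g x)%R] <= (lam^-1)%:E)%E.
Proof.
have /andP[q00 q01] := branch_le1 false zm.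
have tt : - 2^-1 <= t <= 2^-1 by rewrite -ler_norml.
(* Index 2 falls on the [nth] defaults: the complement of [cell z], with weight 1. *)
pose w i := nth 1 [:: 1 + t * (1 - q0); 1 - t * q0] i.
pose A i := nth (~` cell z) [:: cell (rcons z false); cell (rcons z true)] i.
apply: (@measure_exists_prod_ge _ _ _ _ _ Pr P X HX 3 A w).
- move=> [|[|i]]; [exact: measurable_child|exact: measurable_child|].
  rewrite /A /= ?nth_nil; apply: measurableC; by apply: (cell_measurable Hcell); exact: ltnW.
- by move=> [|[|i]] /=; rewrite /w /= ?nth_nil// /q0; nra.
- move=> x; rewrite /node_weight -/q0 !indicE.
  have [xz|xz] := boolP (x \in cell z).
    have := mem_cell_rcons Hcell false zm (set_mem xz); rewrite /=.
    case: (boolP (x \in cell (rcons z false))) => [x0|x0] x1; rewrite x1 /=.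
      by exists 0%N; split => //=; [exact: set_mem|rewrite /w/=; ring].
    by exists 1%N; split => //=; [apply: set_mem; rewrite x1|rewrite /w/=; ring].
  exists 2%N; split => //=; last first.
    by rewrite !(notin_cell_rcons Hcell _ zm xz) /w/=; ring.
  by move=> H; move: xz; rewrite notin_setE.
- exact: measurable_g.
- rewrite !big_ord_recr big_ord0 /= add0r /A /w /= !(branch_cond Hmodel)//.
  have mz : measurable (cell z) by apply: (cell_measurable Hcell); exact: ltnW.
  have fz : P (cell z) \is a fin_num by exact: fin_num_measure.
  rewrite probability_setC//.
  rewrite -[P (cell z)]fineK// -EFinB -!EFinM /=.
  have -> : q (rcons z true) = 1 - q0 by rewrite -(branch_sum Hmodel zm) /q0; ring.
  rewrite le_eqVlt; apply/orP; left; apply/eqP; rewrite /q0; ring.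
Qed.

(** [expR_sub_sqr_le] on each factor: the linear terms combine into the deviation, and the squares
    [(1 - q0) ^+ 2] and [q0 ^+ 2] are bounded by 1. *)
Lemma expR_le_prod_weight (D : seq T) :
  expR (t * ((counts cell D (rcons z false))%:R - q0 * (counts cell D z)%:R) -
    2 * t ^+ 2 * (counts cell D z)%:R) <= \prod_(x <- D) g x.
Proof.
have /andP[q00 q01] := branch_le1 false zm; rewrite -/q0 in q00 q01.
have /andP[t1 t2] : - 2^-1 <= t <= 2^-1 by rewrite -ler_norml.
rewrite prod_weightE (counts_split D zm) natrD.
set a := counts _ _ _; set b := counts _ _ _.
have h1 : -2^-1 <= t * (1 - q0) <= 2^-1 by apply/andP; split; nra.
have h2 : -2^-1 <= - (t * q0) <= 2^-1 by apply/andP; split; nra.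
apply: (@le_trans _ _ (expR (a%:R * (t * (1 - q0) - 2 * (t * (1 - q0)) ^+ 2) +
   b%:R * (- (t * q0) - 2 * (- (t * q0)) ^+ 2)))).
  rewrite ler_expR -subr_ge0.
  have -> : forall A B : R, A * (t * (1 - q0) - 2 * (t * (1 - q0)) ^+ 2) +
      B * (- (t * q0) - 2 * (- (t * q0)) ^+ 2) -
      (t * (A - q0 * (A + B)) - 2 * t ^+ 2 * (A + B)) =
      2 * t ^+ 2 * (A * (q0 * (2 - q0)) + B * ((1 - q0) * (1 + q0))) by move=> A B; ring.
  have [a0 b0] : 0 <= a%:R :> R /\ 0 <= b%:R :> R by [].
  apply: mulr_ge0; first by rewrite mulr_ge0 ?sqr_ge0.
  by apply: addr_ge0; apply: mulr_ge0 => //; apply: mulr_ge0; lra.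
rewrite expRD !expRM_natl; apply: ler_pM; rewrite ?exprn_ge0 ?expR_ge0//.
  by apply: lerXn2r; rewrite ?nnegrE ?expR_ge0 ?expR_sub_sqr_le//; lra.
by apply: lerXn2r; rewrite ?nnegrE ?expR_ge0 ?expR_sub_sqr_le//; lra.
Qed.

End martingale.

(** The count [N] at time [n] is random, so no single stake fits. Ville's inequality controls a
    whole path for each stake [t k], and the stake is picked afterwards from the block containing
    [N]. *)
Lemma ae_fluctuation (z : bitseq) (e : R) : (size z < m)%N -> 0 < e ->
  {ae Pr, forall om, exists N0, forall n,
    let N := counts cell (sample X n om) z in
    (N0 <= N)%N ->
    ((counts cell (sample X n om) (rcons z false))%:R - q (rcons z false) * N%:R) ^+ 2
      <= e * N%:R * ln (N%:R : R)}.
Proof.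
(* On block [k] the squared deviation is at most [25 * y k * 2 ^+ k], and [k <= 2 ln N] turns this
   into [50 * kap * N * ln N]: hence [e / 50]. The bound 1/4 keeps the stake [t k] at most 1/2. *)
move=> zm e0; pose kap := Num.min (e / 50) 4^-1.
have kap0 : 0 < kap by rewrite /kap lt_min divr_gt0//= invr_gt0.
have [kap1 kap2] : kap <= e / 50 /\ kap <= 4^-1 by rewrite /kap !ge_min !lexx orbT.
pose y (k : nat) : R := kap * k%:R.
have y0 k : 0 <= y k by rewrite mulr_ge0// ltW.
pose t k := Num.sqrt (y k / 2 ^+ k).
have p2 k : 0 < 2 ^+ k :> R by rewrite exprn_gt0.
have t2 k : t k ^+ 2 = y k / 2 ^+ k by rewrite sqr_sqrtr// divr_ge0// ltW.
have kle k : k%:R <= 2 ^+ k :> R by rewrite -natrX ler_nat ltnW// ltn_expl.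
have tle k : `|t k| <= 2^-1.
  rewrite ger0_norm ?sqrtr_ge0// -[leRHS]ger0_norm ?invr_ge0// -sqrtr_sqr ler_sqrt.
    rewrite ler_pdivrMr//; apply: (@le_trans _ _ (4^-1 * k%:R)).
      by rewrite ler_wpM2r.
    by rewrite (_ : 2^-1 ^+ 2 = 4^-1 :> R); [rewrite ler_wpM2l ?invr_ge0|field].
  by rewrite exprn_ge0// invr_ge0.
have tle' k : `|- t k| <= 2^-1 by rewrite normrN.
have E (s : nat -> R) : (forall k, `|s k| <= 2^-1) ->
    {ae Pr, forall om, \forall k \near \oo,
      ~ exists n, expR (y k) <= \prod_(x <- sample X n om) node_weight z (s k) x}.
  move=> sle; apply: (ae_eventually_not kap0) => k.
    exact: measurable_weight_crosses.
  by rewrite -/(y k) expRN; apply: measure_weight_crosses => //; exact: expR_gt0.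
apply: filterS2 (E t tle) (E (fun k => - t k) tle') => om H1 H2.
have [k0 _ Hk0] : \forall k \near \oo, [/\ (0 < k)%N,
    ~ (exists n, expR (y k) <= \prod_(x <- sample X n om) node_weight z (t k) x) &
    ~ (exists n, expR (y k) <= \prod_(x <- sample X n om) node_weight z (- t k) x)].
  by near=> k; split; [near: k; exact: nbhs_infty_gt|near: k..].
exists (2 ^ k0)%N => n; set N := counts _ _ _ => /= Nk0.
have N0 : (0 < N)%N by apply: leq_trans Nk0; rewrite expn_gt0.
pose k := trunc_log 2 N.
have /andP[kN Nk] : (2 ^ k <= N < 2 ^ k.+1)%N by apply: trunc_log_bounds.
have /Hk0[k_gt0 h1 h2] : (k0 <= k)%N by apply: trunc_log_max.
set a := counts _ _ (rcons z false); set q0 := q _; set dv := a%:R - q0 * N%:R.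
(* A bet that never crosses gives [s * dv <= y k + 2 s^2 N], and [N < 2 ^ k.+1] makes this at most
   [5 * y k]. Stakes of both signs bound [dv] on both sides. *)
have B (s : R) : `|s| <= 2^-1 -> s ^+ 2 = y k / 2 ^+ k ->
    ~ (exists n, expR (y k) <= \prod_(x <- sample X n om) node_weight z s x) ->
    s * dv <= 5 * y k.
  move=> sle s2 hs.
  have := expR_le_prod_weight zm sle (sample X n om); rewrite -/N -/a -/q0 -/dv => L.
  have : expR (s * dv - 2 * s ^+ 2 * N%:R) < expR (y k).
    by apply: le_lt_trans L _; rewrite ltNge; apply/negP => hn; apply: hs; exists n.
  rewrite ltr_expR s2 => L'.
  have : 2 * (y k / 2 ^+ k) * N%:R <= 4 * y k.
    have -> : 4 * y k = 2 * (y k / 2 ^+ k) * (2 ^+ k.+1) by rewrite exprS; field; rewrite gt_eqF.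
    apply: ler_wpM2l; first by rewrite mulr_ge0// divr_ge0// ltW.
    by rewrite -natrX ler_nat; exact: ltnW.
  by lra.
have b1 := B _ (tle k) (t2 k) h1.
have b2 := B (- t k) (tle' k) (etrans (sqrrN _) (t2 k)) h2.
have yk0 : 0 < y k by rewrite mulr_gt0// ltr0n.
have sq : dv ^+ 2 * (y k / 2 ^+ k) <= 25 * y k ^+ 2.
  rewrite -t2 -exprMn (_ : 25 * y k ^+ 2 = (5 * y k) ^+ 2); last by ring.
  rewrite -[leLHS]real_normK ?num_real//.
  have y5 : 0 <= 5 * y k by apply: mulr_ge0 => //; exact: y0.
  apply: lerXn2r; rewrite ?nnegrE ?normr_ge0//.
  by rewrite ler_norml; apply/andP; split; lra.
have d1 : dv ^+ 2 <= 25 * y k * 2 ^+ k.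
  rewrite -(ler_pM2r (divr_gt0 yk0 (p2 k))); apply: le_trans sq _.
  rewrite le_eqVlt; apply/orP; left; apply/eqP; field; rewrite gt_eqF//.
apply: le_trans d1 _.
have kN' : 2 ^+ k <= N%:R :> R by rewrite -natrX ler_nat.
have lnN : k%:R <= 2 * ln (N%:R : R).
  have : expR (2^-1) <= 2 :> R.
    rewrite -[expR _]invrK -expRN -[leRHS]invrK lef_pV2 ?posrE ?invr_gt0 ?expR_gt0//.
    by apply: le_trans (expR_ge1Dx _); lra.
  move=> e2; have : expR (2^-1 * k%:R) <= N%:R :> R.
    rewrite expRM_natr; apply: le_trans kN'.
    by apply: lerXn2r; rewrite ?nnegrE ?expR_ge0.
  rewrite -ler_ln ?posrE ?expR_gt0 ?ltr0n// expRK; lra.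
have l0 : 0 <= ln (N%:R : R) by rewrite ln_ge0// ler1n.
have y2 : 25 * y k <= e * ln (N%:R : R).
  have : y k <= e / 50 * k%:R by rewrite ler_wpM2r.
  have : e / 50 * k%:R <= e / 50 * (2 * ln (N%:R : R)) by rewrite ler_wpM2l ?divr_ge0// ltW.
  lra.
rewrite (mulrAC e); apply: ler_pM => //.
by apply: mulr_ge0 => //; exact: y0.
Unshelve. all: by end_near. Qed.

End fluctuations.

(** * Asymptotics along a regular sequence of counts *)

Section count_sequences.
Context {R : realType}.
Variables (m : nat) (q : bitseq -> R).
Hypothesis q_ge0 : forall z b, (size z < m)%N -> 0 <= q (rcons z b).
Hypothesis q_sum : forall z, (size z < m)%N ->
  q (rcons z false) + q (rcons z true) = 1.

(** All that the asymptotics use of the sample. The fluctuation bound is conditional on a large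
    count, so it says nothing of cells visited boundedly often; 1/96 is the constant required by
    [beta_evidence_le_powR]. *)
Record regular_counts (c : nat -> bitseq -> nat) : Prop := RegularCounts {
  regular_split : forall n z, (size z < m)%N ->
    c n z = (c n (rcons z false) + c n (rcons z true))%N ;
  regular_fluctuation : forall z, (size z < m)%N -> exists N0, forall n,
    (N0 <= c n z)%N ->
    ((c n (rcons z false))%:R - q (rcons z false) * (c n z)%:R) ^+ 2
      <= 96^-1 * (c n z)%:R * ln ((c n z)%:R : R) }.

Let q_le1 z b : (size z < m)%N -> q (rcons z b) <= 1.
Proof.
move=> zm; have := q_sum zm; have := q_ge0 false zm; have := q_ge0 true zm.
by case: b; lra.
Qed.

Lemma near_count_ge (c : nat -> bitseq -> nat) z (K : R) :
  c n z @[n --> \oo] --> \oo -> \forall n \near \oo, K <= (c n z)%:R.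
Proof.
move=> /cvgnyPge /(_ (Num.truncn K).+1); apply: filterS => n h.
by apply: (@le_trans _ _ (Num.truncn K).+1%:R); rewrite ?ler_nat// ltW// truncnS_gt.
Qed.

(** [ln N <= 2 sqrt N] makes the squared deviation of order [N sqrt N], hence negligible against
    [N^2]; the right child deviates by the opposite amount. *)
Lemma near_count_ratio c z b (e : R) : regular_counts c -> (size z < m)%N ->
  0 < e -> c n z @[n --> \oo] --> \oo ->
  \forall n \near \oo,
    `|(c n (rcons z b))%:R - q (rcons z b) * (c n z)%:R| <= e * (c n z)%:R.
Proof.
move=> rc zm e0 cz; have [N0 hN0] := regular_fluctuation rc zm.
near=> n.
have N1 : 1 <= (c n z)%:R :> R by near: n; exact: near_count_ge.
have Ne : (e ^+ 2)^-1 ^+ 2 <= (c n z)%:R by near: n; exact: near_count_ge.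
have n0 : (N0 <= c n z)%N.
  by rewrite -(ler_nat R); near: n; exact: near_count_ge.
have h := hN0 n n0.
set N : R := (c n z)%:R in N1 Ne h *.
have N0' : 0 < N by lra.
pose r := Num.sqrt N; have r2 : r ^+ 2 = N by rewrite sqr_sqrtr// ltW.
have r0 : 0 < r by rewrite sqrtr_gt0.
have re : (e ^+ 2)^-1 <= r.
  rewrite -[leLHS]ger0_norm ?invr_ge0 ?sqr_ge0// -sqrtr_sqr ler_sqrt//.
have re' : 1 <= e ^+ 2 * r by rewrite -ler_pdivrMl ?exprn_gt0// mulr1.
have lnN : ln N <= 2 * r.
  rewrite -r2 lnXn// mulr2n; have := ln_le_sub1 r0; lra.
suff dF : `|(c n (rcons z false))%:R - q (rcons z false) * N| <= e * N.
  case: b => //; have -> : q (rcons z true) = 1 - q (rcons z false) by rewrite -(q_sum zm); ring.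
  have NE : N = (c n (rcons z false))%:R + (c n (rcons z true))%:R.
    by rewrite /N (regular_split rc n zm) natrD.
  rewrite (_ : _ - _ = - ((c n (rcons z false))%:R - q (rcons z false) * N)); last first.
    by rewrite {1 2}NE; ring.
  by rewrite normrN.
have : `|(c n (rcons z false))%:R - q (rcons z false) * N| ^+ 2 <= (e * N) ^+ 2.
  rewrite real_normK ?num_real//; apply: le_trans h _.
  apply: (@le_trans _ _ (96^-1 * N * (2 * r))).
    by rewrite ler_wpM2l// mulr_ge0// ltW.
  have -> : (e * N) ^+ 2 = N * r * (e ^+ 2 * r) by rewrite -r2; ring.
  have : N * r <= N * r * (e ^+ 2 * r) by rewrite ler_peMr// mulr_ge0// ltW.
  have : 0 < N * r by rewrite mulr_gt0.
  lra.
by rewrite ler_pXn2r// nnegrE mulr_ge0// ltW.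
Unshelve. all: by end_near. Qed.

Lemma cvg_count_child c z b : regular_counts c -> (size z < m)%N ->
  0 < q (rcons z b) -> c n z @[n --> \oo] --> \oo ->
  c n (rcons z b) @[n --> \oo] --> \oo.
Proof.
move=> rc zm qb cz; apply/cvgnyPge => K; near=> n.
have h : `|(c n (rcons z b))%:R - q (rcons z b) * (c n z)%:R| <= q (rcons z b) / 2 * (c n z)%:R.
  by near: n; apply: near_count_ratio => //; rewrite divr_gt0.
have h2 : K%:R / (q (rcons z b) / 2) <= (c n z)%:R by near: n; exact: near_count_ge.
rewrite -(ler_nat R); move: h2; rewrite ler_pdivrMr ?divr_gt0// => h2.
move: h; rewrite ler_norml => /andP[h3 _].
lra.
Unshelve. all: by end_near. Qed.

Fixpoint uniform_below (k : nat) (z : bitseq) : Prop :=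
  if k is k'.+1 then
    [/\ q (rcons z false) = 2^-1, q (rcons z true) = 2^-1,
        uniform_below k' (rcons z false) & uniform_below k' (rcons z true)]
  else True.

(** [chi] stands for the membership map of one point; reading it at the right child selects the
    branch that the point follows. *)
Fixpoint model_likelihood (chi : bitseq -> bool) (k : nat) (z : bitseq) : R :=
  if k is k'.+1 then
    let z' := rcons z (chi (rcons z true)) in 2 * q z' * model_likelihood chi k' z'
  else 1.

Lemma model_likelihood_uniform chi k z : uniform_below k z -> model_likelihood chi k z = 1.
Proof.
elim: k z => //= k IH z [qf qt U0 U1].
by case: (chi _); rewrite IH ?qf ?qt ?mulr1 ?divff.
Qed.

(** * Bounds and limits of the evidence *)

Section evidence_asymptotics.
Variables (alpha u s : R).
Hypotheses (alpha_gt0 : 0 < alpha) (u_ge0 : 0 <= u) (s_ge0 : 0 <= s) (us1 : u + s = 1).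
Local Notation cev := (count_evidence alpha u s).

Lemma count_evidence_gt0 k z c : 0 < cev k z c.
Proof.
elim: k z => [|k IH] z //=.
have h : 0 < beta_evidence alpha (c (rcons z false)) (c (rcons z true)) *
   (cev k (rcons z false) c * cev k (rcons z true) c).
  by rewrite !mulr_gt0 ?beta_evidence_gt0.
have [s0|s0] := eqVneq s 0; first by have := us1; rewrite s0 mul0r !addr0 => ->.
by rewrite ltr_wpDl// mulr_gt0// lt_def s0.
Qed.

(** Each of the [k] levels loses at most a factor [(1 - e) ^+ c n z], since the counts of the
    children add up. *)
Lemma count_evidence_ge (e : R) k : 0 < e < 1 -> 0 < s -> exists2 C : R, 0 < C &
  forall c n z, regular_counts c -> (size z + k <= m)%N ->
    C * (1 - e) ^+ (k * c n z) <= cev k z (c n).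
Proof.
move=> e01 s0; have [K K0 hK] := beta_evidence_ge_expn alpha_gt0 e01.
have e1 : 0 <= 1 - e by case/andP: e01; lra.
elim: k => [|k [C C0 IH]]; first by exists 1 => // *; rewrite mul0n expr0 mulr1.
exists (s * (K * (C * C))); first by rewrite !mulr_gt0.
move=> c n z rc zk /=.
have zm : (size z < m)%N by lia.
rewrite (regular_split rc n zm); set a := c n (rcons z false); set b := c n (rcons z true).
apply: (@le_trans _ _ (s * (beta_evidence alpha a b *
   (cev k (rcons z false) (c n) * cev k (rcons z true) (c n))))); last by rewrite lerDr.
rewrite -!mulrA ler_wpM2l//.
have -> : K * (C * (C * (1 - e) ^+ (k.+1 * (a + b)))) =
   (K * (1 - e) ^+ (a + b)) * ((C * (1 - e) ^+ (k * a)) * (C * (1 - e) ^+ (k * b))).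
  by rewrite mulSn mulnDr !exprD; ring.
apply: ler_pM => //; rewrite ?mulr_ge0 ?exprn_ge0 ?(ltW K0) ?(ltW C0)//.
apply: ler_pM; rewrite ?mulr_ge0 ?exprn_ge0 ?(ltW K0) ?(ltW C0)//.
  by apply: IH => //; rewrite size_rcons; lia.
by apply: IH => //; rewrite size_rcons; lia.
Qed.

(** Lowering the rate absorbs a constant factor. *)
Lemma near_expR_le (c : nat -> bitseq -> nat) z (K r r' : R) : 0 < K -> r' < r -> c n z @[n --> \oo] --> \oo ->
  \forall n \near \oo, expR (r' * (c n z)%:R) <= K * expR (r * (c n z)%:R).
Proof.
move=> K0 rr cz; near=> n.
have h : K^-1 / (r - r') <= (c n z)%:R by near: n; exact: near_count_ge.
set N : R := (c n z)%:R in h *.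
have -> : r * N = r' * N + (r - r') * N by ring.
rewrite expRD mulrCA ler_peMr ?expR_ge0// -ler_pdivrMl// mulr1.
move: h; rewrite ler_pdivrMr ?subr_gt0// => h.
apply: le_trans (expR_ge1Dx _); lra.
Unshelve. all: by end_near. Qed.

Let half_q1 z : (size z < m)%N -> q (rcons z false) = 2^-1 -> q (rcons z true) = 2^-1.
Proof. by move=> zm h; have := q_sum zm; rewrite h; lra. Qed.

(** Either the branching at [z] is biased, so that F grows, or it is fair and some child is
    non-uniform, so that the child evidence grows. In both cases the other factors lose at a rate
    chosen small afterwards. The final rate is fixed before [c], hence is the same for all
    samples. *)
Lemma count_evidence_ge_expR k z : (size z + k <= m)%N -> ~ uniform_below k z -> 0 < s ->
  exists2 r : R, 0 < r & forall c, regular_counts c ->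
    c n z @[n --> \oo] --> \oo ->
    \forall n \near \oo, expR (r * (c n z)%:R) <= cev k z (c n).
Proof.
move=> + + s0; elim: k z => [|k IH] z zk nU; first by case: nU.
have zm : (size z < m)%N by lia.
have k1 : 0 < k.+1%:R :> R by rewrite ltr0n.
(* With [e = 1 - expR (- x)], the geometric lower bounds become exponentials of rate [- x]. *)
have powE (x : R) j : (1 - (1 - expR (- x))) ^+ j = expR (- x * j%:R).
  by rewrite subKr expRM_natr.
have e01 (x : R) : 0 < x -> 0 < 1 - expR (- x) < 1.
  by move=> x0; rewrite subr_gt0 expR_lt1 oppr_lt0 x0/= gtrBl expR_gt0.
have szb b : (size (rcons z b) + k <= m)%N by rewrite size_rcons; lia.
have [q2|q2] := eqVneq (q (rcons z false)) 2^-1; last first.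
  have q01 : 0 <= q (rcons z false) <= 1 by rewrite q_ge0// q_le1.
  have [K K0 hK] := beta_evidence_ge_expR alpha_gt0 q01 q2.
  set rho := 2 * q (rcons z false) - 1 in hK.
  have rho0 : 0 < `|rho|.
    by rewrite normr_gt0 /rho subr_eq0; apply: contra q2 => /eqP h; apply/eqP; lra.
  pose D := rho ^+ 2 / 32.
  have D0 : 0 < D by rewrite divr_gt0// -real_normK ?num_real// exprn_gt0.
  (* The two children together lose at most the rate [x * k <= D / 4], so more than [D / 2] is left;
     going down to [D / 4] absorbs the constants. *)
  pose x := D / 4 / k.+1%:R; have x0 : 0 < x by apply: divr_gt0 => //; apply: divr_gt0.
  have [C C0 hC] := count_evidence_ge k (e01 x x0) s0.
  exists (D / 4); first by rewrite divr_gt0.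
  move=> c rc cz; near=> n.
  have h1 : `|(c n (rcons z false))%:R - q (rcons z false) * (c n z)%:R|
      <= `|rho| / 8 * (c n z)%:R.
    by near: n; apply: near_count_ratio => //; rewrite divr_gt0.
  have h2 : expR (D / 4 * (c n z)%:R) <= s * (K * (C * C)) * expR (D / 2 * (c n z)%:R).
    by near: n; apply: near_expR_le => //; [rewrite !mulr_gt0|lra].
  have c0 := hC c n (rcons z false) rc (szb false).
  have c1 := hC c n (rcons z true) rc (szb true).
  apply: le_trans h2 _ => /=.
  apply: (@le_trans _ _ (s * (beta_evidence alpha (c n (rcons z false)) (c n (rcons z true)) *
    (cev k (rcons z false) (c n) * cev k (rcons z true) (c n))))); last by rewrite lerDr.
  rewrite -!mulrA ler_wpM2l//.
  have := hK (c n (rcons z false)) (c n (rcons z true)); rewrite -(regular_split rc n zm) => /(_ h1) h3.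
  move: h3 c0 c1; rewrite !powE => h3 c0 c1.
  apply: (@le_trans _ _ (K * expR ((c n z)%:R * rho ^+ 2 / 32) *
     ((C * expR (- x * (k * c n (rcons z false))%:R)) * (C * expR (- x * (k * c n (rcons z true))%:R))))).
    have -> : forall E0 E1 E2 : R, K * E0 * (C * E1 * (C * E2)) = K * (C * (C * (E0 * (E1 * E2)))).
      by move=> *; ring.
    rewrite -!expRD !ler_wpM2l ?(ltW K0) ?(ltW C0)// ler_expR.
    have -> : - x * (k * c n (rcons z false))%:R + - x * (k * c n (rcons z true))%:R =
        - (x * k%:R * (c n z)%:R) by rewrite (regular_split rc n zm) !natrM natrD; ring.
    have : x * k%:R <= D / 4.
      rewrite /x -mulrA; apply: ler_piMr; first by apply: divr_ge0 => //; exact: ltW.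
      by rewrite mulrC ler_pdivrMr// mul1r ler_nat.
    have : 0 <= (c n z)%:R :> R by [].
    by rewrite /D; move: (c n z)%:R (x * k%:R) => N y N0 hy; nra.
  apply: ler_pM => //; rewrite ?mulr_ge0 ?expR_ge0 ?(ltW K0) ?(ltW C0)//.
  by apply: ler_pM; rewrite ?mulr_ge0 ?expR_ge0 ?(ltW K0) ?(ltW C0).
have [b nUb] : exists b, ~ uniform_below k (rcons z b).
  apply: contrapT => H; apply: nU => /=; split => //; first exact: half_q1.
    by apply: contrapT => H'; apply: H; exists false.
  by apply: contrapT => H'; apply: H; exists true.
have qb : q (rcons z b) = 2^-1 by case: b {nUb} => //; exact: half_q1.
have [rb rb0 hrb] := IH _ (szb b) nUb.
(* Child [b] receives about half, hence eventually a quarter, of the observations and gains at least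
   the rate [rb / 4]. F and the sibling lose at most [x * k.+1 = rb / 16]. *)
pose x := rb / 16 / k.+1%:R; have x0 : 0 < x by apply: divr_gt0 => //; apply: divr_gt0.
have xk : x * k.+1%:R = rb / 16 by rewrite /x divfK// gt_eqF.
clearbody x.
have [K K0 hK] := beta_evidence_ge_expn alpha_gt0 (e01 x x0).
have [C C0 hC] := count_evidence_ge k (e01 x x0) s0.
exists (rb / 16); first by rewrite divr_gt0.
move=> c rc cz; near=> n.
have h1 : `|(c n (rcons z b))%:R - q (rcons z b) * (c n z)%:R| <= 4^-1 * (c n z)%:R.
  by near: n; apply: near_count_ratio => //; rewrite invr_gt0.
have h2 : expR (rb / 16 * (c n z)%:R) <= s * (K * C) * expR (rb / 8 * (c n z)%:R).
  by near: n; apply: near_expR_le => //; [rewrite !mulr_gt0|lra].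
have h3 : expR (rb * (c n (rcons z b))%:R) <= cev k (rcons z b) (c n).
  by near: n; apply: hrb => //; apply: cvg_count_child => //; rewrite qb invr_gt0.
have c1 := hC c n (rcons z (~~ b)) rc (szb (~~ b)).
apply: le_trans h2 _ => /=.
apply: (@le_trans _ _ (s * (beta_evidence alpha (c n (rcons z false)) (c n (rcons z true)) *
  (cev k (rcons z b) (c n) * cev k (rcons z (~~ b)) (c n))))); last first.
  rewrite (_ : cev k (rcons z b) (c n) * _ =
    cev k (rcons z false) (c n) * cev k (rcons z true) (c n)); first by rewrite lerDr.
  by case: (b) => //=; rewrite mulrC.
rewrite -!mulrA ler_wpM2l//.
have := hK (c n (rcons z false)) (c n (rcons z true)); rewrite -(regular_split rc n zm) => h4.
move: h4 c1; rewrite !powE => h4 c1.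
have cle : (c n (rcons z (~~ b)))%:R <= (c n z)%:R :> R.
  rewrite ler_nat (regular_split rc n zm); case: (b) => /=; lia.
apply: (@le_trans _ _ (K * expR (- x * (c n z)%:R) *
   (expR (rb * (c n (rcons z b))%:R) * (C * expR (- x * (k * c n (rcons z (~~ b)))%:R))))).
  have -> : forall E0 E1 E2 : R, K * E0 * (E1 * (C * E2)) = K * (C * (E0 * (E1 * E2))).
    by move=> *; ring.
  rewrite -!expRD !ler_wpM2l ?(ltW K0) ?(ltW C0)// ler_expR.
  move: h1; rewrite qb ler_norml => /andP[h1 _].
  rewrite natrM; have N0 : 0 <= (c n z)%:R :> R by [].
  have : x * k%:R * (c n (rcons z (~~ b)))%:R <= x * k%:R * (c n z)%:R.
    by rewrite ler_wpM2l// mulr_ge0// ltW.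
  have : rb * (4^-1 * (c n z)%:R) <= rb * (c n (rcons z b))%:R.
    by rewrite ler_wpM2l ?(ltW rb0)//; lra.
  have : x * (c n z)%:R + x * k%:R * (c n z)%:R = rb / 16 * (c n z)%:R.
    by rewrite -xk -natr1; ring.
  have : 0 <= rb * (c n z)%:R by rewrite mulr_ge0// ltW.
  by lra.
apply: ler_pM => //; rewrite ?mulr_ge0 ?expR_ge0 ?(ltW K0) ?(ltW C0)//.
by apply: ler_pM; rewrite ?mulr_ge0 ?expR_ge0 ?(ltW C0).
Unshelve. all: by end_near. Qed.

Lemma cvg_count_powR (c : nat -> bitseq -> nat) z (b : R) : 0 < b -> c n z @[n --> \oo] --> \oo ->
  ((c n z)%:R : R) `^ (- b) @[n --> \oo] --> (0 : R).
Proof.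
move=> b0 cz; apply/cvgrPdist_le => e e0; near=> n.
have N1 : 1 <= (c n z)%:R :> R by near: n; exact: near_count_ge.
have Ne : (e^-1) `^ b^-1 <= (c n z)%:R by near: n; exact: near_count_ge.
rewrite sub0r normrN ger0_norm ?powR_ge0// powRN -[leRHS]invrK.
have N0 : 0 < (c n z)%:R :> R by lra.
rewrite lef_pV2 ?posrE ?powR_gt0 ?invr_gt0//.
have := @ge0_ler_powR R b (ltW b0) _ _ _ _ Ne; rewrite -powRrM mulVf ?gt_eqF// powRr1 ?invr_ge0 ?(ltW e0)//.
by apply; rewrite nnegrE ?powR_ge0// ltW.
Unshelve. all: by end_near. Qed.

Lemma near_beta_evidence_le_powR : exists2 C : R, 0 < C & forall c z,
  regular_counts c -> (size z < m)%N -> q (rcons z false) = 2^-1 ->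
  c n z @[n --> \oo] --> \oo ->
  \forall n \near \oo, beta_evidence alpha (c n (rcons z false)) (c n (rcons z true))
     <= C * ((c n z)%:R : R) `^ (- 8^-1).
Proof.
have [C C0 hC] := beta_evidence_le_powR alpha_gt0; exists C => // c z rc zm q2 cz.
have [N0 hN0] := regular_fluctuation rc zm.
near=> n.
have n0 : (N0 <= c n z)%N by rewrite -(ler_nat R); near: n; exact: near_count_ge.
have n1 : (1 <= c n z)%N by rewrite -(ler_nat R); near: n; exact: near_count_ge.
have := hN0 n n0; rewrite q2 (regular_split rc n zm) => h; apply: hC => //.
by rewrite -(regular_split rc n zm).
Unshelve. all: by end_near. Qed.

(** Fair branchings send the counts of both children to infinity, so both induction hypotheses
    apply, while F is bounded. *)
Lemma count_evidence_bounded k z : (size z + k <= m)%N -> uniform_below k z ->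
  exists2 B : R, 0 < B & forall c, regular_counts c -> c n z @[n --> \oo] --> \oo ->
    \forall n \near \oo, cev k z (c n) <= B.
Proof.
elim: k z => [|k IH] z zk /=; first by exists 1 => // c _ _; exact: nearW.
move=> [q2 q2' U0 U1].
have zm : (size z < m)%N by lia.
have szb b : (size (rcons z b) + k <= m)%N by rewrite size_rcons; lia.
have [B0 B00 hB0] := IH _ (szb false) U0.
have [B1 B10 hB1] := IH _ (szb true) U1.
have [C C0 hC] := near_beta_evidence_le_powR.
exists (u + s * (C * (B0 * B1)) + 1); first by rewrite ltr_wpDl// addr_ge0// !mulr_ge0// ltW.
move=> c rc cz; near=> n.
have N1 : 1 <= (c n z)%:R :> R by near: n; exact: near_count_ge.
have h0 : cev k (rcons z false) (c n) <= B0.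
  by near: n; apply: hB0 => //; apply: cvg_count_child => //; rewrite q2 invr_gt0.
have h1 : cev k (rcons z true) (c n) <= B1.
  by near: n; apply: hB1 => //; apply: cvg_count_child => //; rewrite q2' invr_gt0.
have h2 : beta_evidence alpha (c n (rcons z false)) (c n (rcons z true))
     <= C * ((c n z)%:R : R) `^ (- 8^-1) by near: n; exact: hC.
rewrite -addrA lerD2l ler_wpDr// ler_wpM2l//.
apply: ler_pM; rewrite ?mulr_ge0 ?(ltW (beta_evidence_gt0 _ _ _)) ?(ltW (count_evidence_gt0 _ _ _))//.
  apply: le_trans h2 _; rewrite ler_piMr ?(ltW C0)//.
  rewrite powRN invf_le1 ?powR_gt0//; last by lra.
  by rewrite -[leLHS](powRr0 (c n z)%:R) ler_powR// invr_ge0.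
by apply: ler_pM; rewrite ?(ltW (count_evidence_gt0 _ _ _)).
Unshelve. all: by end_near. Qed.

(** The exponent 1/8 is that of F at the top node; the child evidences contribute only the constant
    [B0 * B1]. *)
Lemma count_evidence_cvg_polynomially k z : (size z + k.+1 <= m)%N ->
  uniform_below k.+1 z -> forall c, regular_counts c -> c n z @[n --> \oo] --> \oo ->
    cvg_polynomially (fun n => c n z) (fun n => cev k.+1 z (c n)) u 8^-1.
Proof.
move=> zk [q2 q2' U0 U1] c rc cz.
have zm : (size z < m)%N by lia.
have szb b : (size (rcons z b) + k <= m)%N by rewrite size_rcons; lia.
have [B0 B00 hB0] := count_evidence_bounded (szb false) U0.
have [B1 B10 hB1] := count_evidence_bounded (szb true) U1.
have [C C0 hC] := near_beta_evidence_le_powR.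
pose C' := s * (C * (B0 * B1)).
have H : \forall n \near \oo, `|cev k.+1 z (c n) - u| <= C' * ((c n z)%:R : R) `^ (- 8^-1).
  near=> n.
  have h0 : cev k (rcons z false) (c n) <= B0.
    by near: n; apply: hB0 => //; apply: cvg_count_child => //; rewrite q2 invr_gt0.
  have h1 : cev k (rcons z true) (c n) <= B1.
    by near: n; apply: hB1 => //; apply: cvg_count_child => //; rewrite q2' invr_gt0.
  have h2 : beta_evidence alpha (c n (rcons z false)) (c n (rcons z true))
       <= C * ((c n z)%:R : R) `^ (- 8^-1) by near: n; exact: hC.
  have p0 w : 0 <= cev k w (c n) by rewrite ltW// count_evidence_gt0.
  have b0 a b : 0 <= beta_evidence alpha a b by rewrite ltW// beta_evidence_gt0.
  rewrite /= addrC addKr ger0_norm ?mulr_ge0//.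
  rewrite /C' -mulrA ler_wpM2l// (_ : C * (B0 * B1) * _ = C * (c n z)%:R `^ (- 8^-1) * (B0 * B1)); last by ring.
  by apply: ler_pM; rewrite ?mulr_ge0//; apply: ler_pM.
split; last by exists C'.
have L : C' * ((c n z)%:R : R) `^ (- 8^-1) @[n --> \oo] --> 0.
  by rewrite -(mulr0 C'); apply: cvgMr; apply: cvg_count_powR => //; rewrite invr_gt0.
apply/cvgrPdist_le => e e0; move/cvgrPdist_le : L => /(_ e e0).
apply: filterS2 H => n h1; rewrite sub0r normrN distrC.
by apply: le_trans; apply: le_trans h1 _; exact: ler_norm.
Unshelve. all: by end_near. Qed.

(** * The predictive distribution as the effect of one more observation *)

Section new_observation.
Variable chi : bitseq -> bool.
Hypothesis chi_child : forall z, (size z < m)%N -> chi z ->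
  chi (rcons z true) = ~~ chi (rcons z false).
Hypothesis chi_sub : forall z b, (size z < m)%N -> chi (rcons z b) -> chi z.

Definition add_observation (c : bitseq -> nat) (w : bitseq) : nat := (c w + chi w)%N.

Let chi_cat z y : (size (z ++ y) <= m)%N -> ~~ chi z -> ~~ chi (z ++ y).
Proof.
elim/last_ind: y => [|y b IH]; first by rewrite cats0.
rewrite -rcons_cat size_rcons => h nz; apply: contra (IH (ltnW h) nz); exact: chi_sub.
Qed.

Lemma count_evidence_add_other k z c : (size z + k <= m)%N -> ~~ chi z ->
  cev k z (add_observation c) = cev k z c.
Proof.
move=> zk nz; apply: eq_count_evidence => y /andP[_ yk].
rewrite /add_observation (negbTE (chi_cat _ nz)) ?addn0// size_cat; lia.
Qed.

Let ratio (c : bitseq -> nat) z b : R := 2 * (alpha + (c (rcons z b))%:R) / (2 * alpha + (c z)%:R).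

(** The new point leaves the sibling subtree unchanged and multiplies F by the rule of
    succession. *)
Lemma count_evidence_add k z c : (size z + k.+1 <= m)%N -> chi z ->
  c z = (c (rcons z false) + c (rcons z true))%N ->
  let b := chi (rcons z true) in
  cev k.+1 z (add_observation c) =
  u + s * (ratio c z b * beta_evidence alpha (c (rcons z false)) (c (rcons z true)) *
    (cev k (rcons z b) (add_observation c) * cev k (rcons z (~~ b)) c)).
Proof.
move=> zk chz cz; have zm : (size z < m)%N by lia.
have a0 : 2 * alpha + (c z)%:R != 0 by rewrite gt_eqF// ltr_wpDr// mulr_gt0.
have := chi_child zm chz.
rewrite /= {1 2}/add_observation; case: (boolP (chi (rcons z false))) => h1 h2; rewrite h2 /=.
  rewrite addn1 addn0 (@count_evidence_add_other k (rcons z true)) ?size_rcons ?h2//; last by lia.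
  rewrite (_ : beta_evidence alpha (c (rcons z false)).+1 _ =
    ratio c z false * beta_evidence alpha (c (rcons z false)) (c (rcons z true)))//.
  by apply: (mulfI a0); rewrite {1}cz beta_evidenceSl// /ratio; field.
rewrite addn1 addn0 (@count_evidence_add_other k (rcons z false)) ?size_rcons//; last by lia.
rewrite (_ : beta_evidence alpha _ (c (rcons z true)).+1 =
  ratio c z true * beta_evidence alpha (c (rcons z false)) (c (rcons z true))).
  by rewrite (mulrC (cev k (rcons z false) c)).
by apply: (mulfI a0); rewrite {1}cz beta_evidenceSr// /ratio; field.
Qed.

Let ratio_ge0 c z b : 0 <= ratio c z b.
Proof. by rewrite divr_ge0// ?mulr_ge0 ?addr_ge0 ?mulr_ge0// ltW. Qed.

Let ratio_le2 c z b : c z = (c (rcons z false) + c (rcons z true))%N -> ratio c z b <= 2.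
Proof.
move=> cz; rewrite ler_pdivrMr; last by rewrite ltr_wpDr// mulr_gt0.
have : (c (rcons z b))%:R <= (c z)%:R :> R by rewrite ler_nat cz; case: b; lia.
by have := alpha_gt0; lra.
Qed.

Let predictive_rate k z c := cev k z (add_observation c) / cev k z c.

Let predictive_rate_ge0 k z c : 0 <= predictive_rate k z c.
Proof. by rewrite divr_ge0// ltW// count_evidence_gt0. Qed.

Let predictive_rateE k z c : (size z + k.+1 <= m)%N -> chi z ->
  c z = (c (rcons z false) + c (rcons z true))%N ->
  let b := chi (rcons z true) in
  exists w, [/\ 0 <= w, w = u / cev k.+1 z c, w <= 1 &
    predictive_rate k.+1 z c = w + (1 - w) * (ratio c z b * predictive_rate k (rcons z b) c)].
Proof.
move=> zk chz cz b; exists (u / cev k.+1 z c).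
have p0 k' w : 0 < cev k' w c by exact: count_evidence_gt0.
have b0 a a' : 0 < beta_evidence alpha a a' by exact: beta_evidence_gt0.
split => //; first by rewrite divr_ge0// ltW.
  by rewrite ler_pdivrMr// mul1r /= lerDl !mulr_ge0// ltW.
rewrite /predictive_rate count_evidence_add// -/b.
have -> : 1 - u / cev k.+1 z c = s * (beta_evidence alpha (c (rcons z false)) (c (rcons z true)) *
    (cev k (rcons z b) c * cev k (rcons z (~~ b)) c)) / cev k.+1 z c.
  have E : cev k.+1 z c = u + s * (beta_evidence alpha (c (rcons z false)) (c (rcons z true)) *
    (cev k (rcons z b) c * cev k (rcons z (~~ b)) c)).
    by rewrite /=; congr (_ + _ * (_ * _)); case: (b) => //=; rewrite mulrC.
  have := p0 k.+1 z; rewrite E; set Y := s * _ => Y0; field.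
  by rewrite gt_eqF.
have c1 : cev k (rcons z b) c != 0 by rewrite gt_eqF.
have c2 : cev k.+1 z c != 0 by rewrite gt_eqF.
by field; rewrite c1 c2.
Qed.

(** Serves branches of probability 0, where the count of the child may stay bounded and no limit of
    its predictive rate is available. *)
Let predictive_rate_le k z c n : regular_counts c -> (size z + k <= m)%N -> chi z ->
  predictive_rate k z (c n) <= 2 ^+ k.
Proof.
move=> rc; elim: k z => [|k IH] z zk chz; first by rewrite /predictive_rate /= divr1.
have zm : (size z < m)%N by lia.
have [w [w0 _ w1 ->]] := predictive_rateE zk chz (regular_split rc n zm).
set b := chi _; have chb : chi (rcons z b).
  by rewrite /b; have := chi_child zm chz; case E : (chi (rcons z true)) => // /esym/negbFE.
have h : ratio (c n) z b * predictive_rate k (rcons z b) (c n) <= 2 ^+ k.+1.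
  rewrite exprS; apply: ler_pM; [exact: ratio_ge0|exact: predictive_rate_ge0| |].
    exact: ratio_le2 (regular_split rc n zm).
  by apply: IH => //; rewrite size_rcons; lia.
have h1 : 1 <= 2 ^+ k.+1 :> R by rewrite exprn_ege1// ler1n.
have : (1 - w) * (ratio (c n) z b * predictive_rate k (rcons z b) (c n)) <= (1 - w) * 2 ^+ k.+1.
  by rewrite ler_wpM2l// subr_ge0.
have : 0 <= w * (2 ^+ k.+1 - 1) by rewrite mulr_ge0// subr_ge0.
lra.
Qed.

Let cvg_ratio c z b : regular_counts c -> (size z < m)%N -> c n z @[n --> \oo] --> \oo ->
  ratio (c n) z b @[n --> \oo] --> 2 * q (rcons z b).
Proof.
move=> rc zm cz; apply/cvgrPdist_le => e e0; near=> n.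
have h1 : `|(c n (rcons z b))%:R - q (rcons z b) * (c n z)%:R| <= e / 4 * (c n z)%:R.
  by near: n; apply: near_count_ratio => //; rewrite divr_gt0.
(* Beyond this count the prior contributes at most [2 * alpha <= e / 2 * N] to the numerator of the
   error. *)
have h2 : 4 * alpha / e <= (c n z)%:R by near: n; exact: near_count_ge.
rewrite distrC /ratio; set N : R := (c n z)%:R in h1 h2 *.
set a : R := (c n (rcons z b))%:R in h1 *; set p := q _ in h1 *.
have N0 : 0 <= N by [].
have d0 : 0 < 2 * alpha + N by rewrite ltr_wpDr// mulr_gt0.
have -> : 2 * (alpha + a) / (2 * alpha + N) - 2 * p =
    (2 * alpha * (1 - 2 * p) + 2 * (a - p * N)) / (2 * alpha + N).
  by field; rewrite gt_eqF.
rewrite normrM normfV (gtr0_norm d0) ler_pdivrMr//.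
apply: le_trans (ler_normD _ _) _.
have p1 : `|1 - 2 * p| <= 1.
  have := q_ge0 b zm; have := q_le1 b zm; rewrite -/p ler_norml => *.
  by apply/andP; split; lra.
rewrite !normrM !(ger0_norm (_ : 0 <= 2)) // (gtr0_norm alpha_gt0).
have : 2 * alpha * `|1 - 2 * p| <= 2 * alpha by rewrite ler_piMr// mulr_ge0// ltW.
have : 0 < e * alpha by rewrite mulr_gt0.
move: h2; rewrite ler_pdivrMr//; lra.
Unshelve. all: by end_near. Qed.

(** The error is [w * (1 - L) + (1 - w) * (x n - L)] with [w = u / p_z]. The first term vanishes
    because [L = 1] in the uniform case and because [w] tends to 0 otherwise. *)
Lemma cvg_predictive_rate k z c : regular_counts c -> (size z + k <= m)%N -> chi z ->
  0 < s \/ uniform_below k z -> c n z @[n --> \oo] --> \oo ->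
  predictive_rate k z (c n) @[n --> \oo] --> model_likelihood chi k z.
Proof.
move=> rc; elim: k z => [|k IH] z zk chz sU cz.
  by rewrite /predictive_rate /=; under eq_cvg do rewrite divr1; exact: cvg_cst.
have zm : (size z < m)%N by lia.
rewrite /=; set b := chi (rcons z true).
have chb : chi (rcons z b).
  by rewrite /b; have := chi_child zm chz; case E : (chi (rcons z true)) => // /esym/negbFE.
have szb : (size (rcons z b) + k <= m)%N by rewrite size_rcons; lia.
pose x n := ratio (c n) z b * predictive_rate k (rcons z b) (c n).
set L := 2 * _ * _.
have xL : x n @[n --> \oo] --> L.
  (* If the branch has probability 0, its ratio tends to 0 and the bounded child rate suffices;
     otherwise the count of the child diverges and induction applies. *)
  have [qb|qb] := eqVneq (q (rcons z b)) 0.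
    have r0 := cvg_ratio (b := b) rc zm cz.
    rewrite /L qb mulr0 mul0r; rewrite qb mulr0 in r0.
    apply: (@squeeze_cvgr _ _ _ _ (fun=> 0) (fun n => ratio (c n) z b * 2 ^+ k)).
    - apply: nearW => n; rewrite /x mulr_ge0//= ler_wpM2l//.
      exact: predictive_rate_le.
    - exact: cvg_cst.
    - by rewrite -(mul0r (2 ^+ k)); exact: cvgMl.
  apply: cvgM; first exact: cvg_ratio.
  apply: IH => //; last first.
    by apply: cvg_count_child => //; rewrite lt_def qb q_ge0.
  by case: sU => [|[_ _ U0 U1]]; [left|right; case: (b)].
have wL : u / cev k.+1 z (c n) * `|1 - L| @[n --> \oo] --> 0.
  have [U|nU] := pselect (uniform_below k.+1 z).
    have -> : L = 1 by exact: (model_likelihood_uniform chi U).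
    rewrite subrr normr0; under eq_cvg do rewrite mulr0; exact: cvg_cst.
  have s0 : 0 < s by case: sU.
  have [r r0 hr] := count_evidence_ge_expR zk nU s0.
  rewrite -(mul0r `|1 - L|); apply: cvgMl.
  apply/cvgrPdist_le => e e0; near=> n.
  have h1 : expR (r * (c n z)%:R) <= cev k.+1 z (c n) by near: n; exact: hr.
  have h2 : u / e / r <= (c n z)%:R by near: n; exact: near_count_ge.
  have p0 : 0 < cev k.+1 z (c n) by exact: count_evidence_gt0.
  rewrite sub0r normrN ger0_norm; last by rewrite divr_ge0// ltW.
  rewrite ler_pdivrMr// -ler_pdivrMl// mulrC; apply: le_trans h1.
  apply: le_trans (expR_ge1Dx _); move: h2; rewrite ler_pdivrMr//.
  by move: (u / e) => v; lra.
apply/cvgrPdist_le => e e0.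
have e2 : 0 < e / 2 by rewrite divr_gt0.
move/cvgrPdist_le : xL => /(_ _ e2) xL; move/cvgrPdist_le : wL => /(_ _ e2).
apply: filterS2 xL => n h1 h2.
have [w [w0 wE w1 ->]] := predictive_rateE zk chz (regular_split rc n zm).
rewrite -/b -/(x n).
rewrite -wE sub0r normrN ger0_norm ?mulr_ge0// in h2.
rewrite distrC (_ : _ - L = w * (1 - L) + (1 - w) * (x n - L)); last by ring.
apply: le_trans (ler_normD _ _) _; rewrite !normrM (ger0_norm w0) (@ger0_norm _ (1 - w)) ?subr_ge0//.
have : (1 - w) * `|x n - L| <= `|x n - L| by rewrite ler_piMl//; lra.
by move: h1; rewrite (distrC L); lra.
Unshelve. all: by end_near. Qed.
End new_observation.
End evidence_asymptotics.
End count_sequences.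

(** * Uniformity read on branchings, and almost sure regularity *)

Section tree_models.
Context {d : measure_display} {T : measurableType d} {R : realType}.
Variables (vol : probability T R) (m : nat) (cell : bitseq -> set T).
Hypothesis Hcell : tree_partition vol m cell.
Variables (P : probability T R) (q : bitseq -> R).
Hypothesis Hmodel : tree_model vol m cell P q.

Lemma volume_cell z : (size z <= m)%N -> vol (cell z) = (2^-1 ^+ size z)%:E.
Proof.
elim/last_ind: z => [|z b IH]; first by rewrite (cell_nil Hcell) probability_setT expr0.
rewrite size_rcons => zm; rewrite (cell_half Hcell)// IH ?(ltnW zm)//.
by rewrite -EFinM -exprS.
Qed.

Lemma cell_nonempty z : (size z <= m)%N -> cell z !=set0.
Proof.
move=> zm; apply/set0P/eqP => z0; have := volume_cell zm.
rewrite z0 measure0 => /esym/eqP; rewrite eqe; apply/negP.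
by rewrite expf_neq0// invr_eq0.
Qed.

Lemma likelihood1_rcons z b x : (size z < m)%N -> cell (rcons z b) x ->
  likelihood1 m cell z q x = 2 * q (rcons z b) * likelihood1 m cell (rcons z b) q x.
Proof.
move=> zm xb; rewrite /likelihood1 big_ltn; last by rewrite ltnS.
by rewrite size_rcons -[in LHS](size_rcons z b) (address_eq Hcell)// size_rcons.
Qed.

Lemma likelihood1_model x k z : (size z + k = m)%N -> cell z x ->
  likelihood1 m cell z q x = model_likelihood q (fun w => x \in cell w) k z.
Proof.
elim: k z => [|k IH] z zk xz; first by rewrite /likelihood1 big_geq// -zk addn0.
have zm : (size z < m)%N by lia.
have xb : cell (rcons z (x \in cell (rcons z true))) x.
  have := mem_cell_rcons Hcell true zm xz; rewrite /=.
  by case: (boolP (x \in cell (rcons z true))) => [/set_mem//|_] /= /set_mem.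
by rewrite (likelihood1_rcons zm xb) (IH (rcons z _))// size_rcons; lia.
Qed.

(** A general constant [v] is needed for the induction, since below child [b] the constant becomes
    [v / (2 q_zb)]. In all cases [v = 2 q_zb] for both children, including a child of probability 0,
    and [q_z0 + q_z1 = 1] forces 1/2. *)
Lemma constant_likelihood1 k z (v : R) : (size z + k = m)%N ->
  (forall x, cell z x -> likelihood1 m cell z q x = v) ->
  v = 1 /\ uniform_below q k z.
Proof.
elim: k z v => [|k IH] z v zk zv.
  have [x xz] : cell z !=set0 by apply: cell_nonempty; lia.
  by rewrite -(zv x xz) /likelihood1 big_geq// -zk addn0.
have zm : (size z < m)%N by lia.
have zb b : (size (rcons z b) + k = m)%N by rewrite size_rcons; lia.
have H b : v = 2 * q (rcons z b) /\ (q (rcons z b) != 0 -> uniform_below q k (rcons z b)).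
  have [x xb] : cell (rcons z b) !=set0 by apply: cell_nonempty; rewrite size_rcons.
  have [q0|q0] := eqVneq (q (rcons z b)) 0.
    split => //; rewrite -(zv x); last exact: (cell_rcons_sub Hcell zm xb).
    by rewrite (likelihood1_rcons zm xb) q0 mulr0 mul0r.
  have [|v1 U] := IH (rcons z b) (v / (2 * q (rcons z b))) (zb b).
    move=> y yb; rewrite -(zv y); last exact: (cell_rcons_sub Hcell zm yb).
    by rewrite (likelihood1_rcons zm yb) mulrAC divff ?mul1r// mulf_neq0.
  by split => //; exact: divr1_eq.
have [v0 U0] := H false; have [v1 U1] := H true.
have qs := branch_sum Hmodel zm.
have q0 : q (rcons z false) = 2^-1 by lra.
have q1 : q (rcons z true) = 2^-1 by lra.
split; first by rewrite v0 q0 divff.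
by split => //; [apply: U0; rewrite q0|apply: U1; rewrite q1]; rewrite invr_eq0.
Qed.

Lemma is_uniformP k z : (size z + k = m)%N ->
  is_uniform m cell q z <-> uniform_below q k z.
Proof.
move=> zk; split => [U|U x xz]; first by have [] := constant_likelihood1 zk U.
by rewrite (likelihood1_model zk xz) model_likelihood_uniform.
Qed.

Context {d' : measure_display} {Om : measurableType d'}.
Variables (Pr : probability Om R) (X : nat -> {mfun Om >-> T}).
Hypothesis HX : iid Pr P X.

(** The nodes are countably many, so the exceptional null sets are united along the enumeration
    [unpickle]. *)
Lemma ae_regular_counts :
  {ae Pr, forall om, regular_counts m q (fun n => counts cell (sample X n om))}.
Proof.
have H (i : nat) : {ae Pr, forall om, forall z : bitseq, unpickle i = Some z ->
    (size z < m)%N -> exists N0, forall n,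
    (N0 <= counts cell (sample X n om) z)%N ->
    ((counts cell (sample X n om) (rcons z false))%:R -
       q (rcons z false) * (counts cell (sample X n om) z)%:R) ^+ 2
      <= 96^-1 * (counts cell (sample X n om) z)%:R *
         ln ((counts cell (sample X n om) z)%:R : R)}.
  case E : (@unpickle bitseq i) => [z|]; last by apply: aeW.
  have [zm|zm] := ltnP (size z) m; last first.
    by apply: aeW => om w [<-]; rewrite ltnNge zm.
  have e0 : 0 < 96^-1 :> R by rewrite invr_gt0.
  apply: filterS (ae_fluctuation Hcell Hmodel HX zm e0) => om [N0 h] w [<-] _.
  by exists N0.
move/ae_foralln : H; apply: filterS => om H; split.
  by move=> n z zm; exact: (counts_split Hcell).
by move=> z zm; apply: (H (pickle z)) => //; exact: pickleK.
Qed.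

End tree_models.

Theorem theorem4
  (R : realType) (d : measure_display) (T : measurableType d)
  (vol : probability T R) (m : nat) (cell : bitseq -> set T)
  (Hcell : tree_partition vol m cell)
  (P : probability T R) (qdot : bitseq -> R)
  (Hmodel : tree_model vol m cell P qdot)
  (alpha : R) (Halpha : 0 < alpha)
  (u s : {nonneg R}) (Hus : u%:num + s%:num = 1)
  (d' : measure_display) (Om : measurableType d') (Pr : probability Om R)
  (X : nat -> {mfun Om >-> T}) (HX : iid Pr P X)
  (z : bitseq) (Hz : (size z <= m)%N) :
  let Dz := fun (w : Om) (n : nat) => sublist cell z (sample X n w) in
  let nz := fun (w : Om) (n : nat) => size (Dz w n) in
  let p := evidence m cell alpha u s z in
  [/\ (* (a) *)
      0 < s%:num \/ is_uniform m cell qdot z ->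
        {ae Pr, forall w, nz w n @[n --> \oo] --> \oo ->
          forall x, cell z x ->
            predictive m cell alpha u s z (Dz w n) x @[n --> \oo]
              --> likelihood1 m cell z qdot x},
      (* (b) *)
      is_uniform m cell qdot z -> (size z < m)%N ->
        exists2 b : R, 0 < b &
          {ae Pr, forall w, nz w n @[n --> \oo] --> \oo ->
            cvg_polynomially (nz w) (fun n => p (Dz w n)) u%:num b},
      (* (c) *)
      size z = m -> forall D : seq T, p (sublist cell z D) = 1
    & (* (d) *)
      ~ is_uniform m cell qdot z -> 0 < s%:num ->
        exists2 c : R, 0 < c &
          {ae Pr, forall w, nz w n @[n --> \oo] --> \oo ->
            dvg_exponentially (nz w) (fun n => p (Dz w n)) c}].
Proof.
move=> Dz nz p.
have aer := ae_regular_counts Hcell Hmodel HX.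
pose k := (m - size z)%N; have zk : (size z + k)%N = m by rewrite subnKC.
have zk' : (size z + k <= m)%N by rewrite zk.
have q_ge0 := @branch_ge0 _ _ _ _ _ _ _ _ Hmodel.
have q_sum := @branch_sum _ _ _ _ _ _ _ _ Hmodel.
have [u_ge0 s_ge0] : 0 <= u%:num /\ 0 <= s%:num by [].
have U := is_uniformP Hcell Hmodel zk.
have pE w n : p (Dz w n) =
    count_evidence alpha u%:num s%:num k z (counts cell (sample X n w)).
  exact: (evidence_sublist Hcell).
split.
(* The almost sure event is fixed before [x], so the convergence holds for all points of the cell at
   once. *)
- move=> sU; apply: filterS aer => w rc cz x xz.
  rewrite (likelihood1_model Hcell _ zk xz).
  pose chi v := x \in cell v.
  have chi_child v : (size v < m)%N -> chi v -> chi (rcons v true) = ~~ chi (rcons v false).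
    by move=> vm /set_mem xv; exact: (mem_cell_rcons Hcell false vm xv).
  have chi_sub v b : (size v < m)%N -> chi (rcons v b) -> chi v.
    move=> vm /set_mem xv; apply/mem_set; exact: (cell_rcons_sub Hcell vm xv).
  have chz : chi z by exact: mem_set.
  have sU' : 0 < s%:num \/ uniform_below qdot k z by case: sU => [|/U]; [left|right].
  have predE n : predictive m cell alpha u s z (Dz w n) x =
      count_evidence alpha u%:num s%:num k z
        (add_observation chi (counts cell (sample X n w))) /
      count_evidence alpha u%:num s%:num k z (counts cell (sample X n w)).
    rewrite /predictive; congr (_ / _); last by rewrite -pE.
    (* As [x] lies in [cell z], appending it commutes with restriction to the cell, and the evidence
       of the longer list is again a function of counts. *)
    rewrite (_ : rcons (Dz w n) x = sublist cell z (rcons (sample X n w) x)); last first.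
      by rewrite /Dz /sublist filter_rcons (mem_set xz).
    rewrite (evidence_sublist Hcell)//; congr count_evidence; apply/funext => v.
    rewrite /add_observation /counts /sublist filter_rcons /chi.
    by case: ifP; rewrite ?size_rcons ?addn1 ?addn0.
  under eq_cvg do rewrite predE.
  exact: (cvg_predictive_rate q_ge0 q_sum Halpha u_ge0 s_ge0 Hus chi_child chi_sub
    rc zk' chz sU' cz).
- move=> /U Uz zm; exists 8^-1; first by rewrite invr_gt0.
  apply: filterS aer => w rc cz.
  (* At least one level remains below [z]; at depth 0 the evidence is 1 rather than close to [u]. *)
  have kE : k = k.-1.+1 by rewrite prednK// subn_gt0.
  rewrite kE in zk' Uz.
  have := count_evidence_cvg_polynomially q_sum Halpha u_ge0 s_ge0 Hus zk' Uz rc cz.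
  rewrite -kE; suff -> : (fun n => p (Dz w n)) =
    (fun n => count_evidence alpha u%:num s%:num k z (counts cell (sample X n w))) by [].
  by apply/funext => n; exact: pE.
- by move=> zm D; rewrite /p (evidence_sublist Hcell)// zm subnn.
- move=> nU s0.
  have nU' : ~ uniform_below qdot k z by move=> /U.
  have [r r0 hr] := count_evidence_ge_expR q_ge0 q_sum Halpha u_ge0 s_ge0 zk' nU' s0.
  exists r => //; apply: filterS aer => w rc cz.
  have H := hr _ rc cz.
  have H' : \forall n \near \oo, expR (r * (nz w n)%:R) <= p (Dz w n).
    by apply: filterS H => n; rewrite pE.
  split => //; apply/cvgryPge => K; near=> n.
  have h1 : K / r <= (counts cell (sample X n w) z)%:R.
    by near: n; exact: (near_count_ge (c := fun n => counts cell (sample X n w))).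
  have h2 : expR (r * (counts cell (sample X n w) z)%:R) <= p (Dz w n) by near: n.
  apply: le_trans h2; apply: le_trans (expR_ge1Dx _).
  by move: h1; rewrite ler_pdivrMr//; lra.
Unshelve. all: by end_near. Qed.
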